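(* Let $A$ be an unbounded nonnegative discrete multiplication operator on a Hilbert space $\mathcal{H}$, with eigenbasis $\{e_i\}$ and eigenvalues $\lambda_i^2$. Let $\mu_1,\mu_2,\alpha,H$ be real numbers with $0<\mu_1<\mu_2$, $\alpha\in(0,1)$, $H>0$. Let $\delta,\sigma,s,S$ be real numbers with $$0\le\delta<\frac{H}{32\,\mu_2^{(1+\alpha)/2}},\qquad 2\sigma=1-\alpha,\qquad s=S=\frac{1}{1-\alpha}.$$ Then the set of propagation speeds $c\in\mathcal{PS}(\mu_1,\mu_2,\alpha,H)$ for which the equation $u''+2\delta A^{\sigma}u'+c(t)Au=0$ admits a very weak solution $u$ satisfying $$(u(0),u'(0))\in\mathcal{G}_{s,\log,1/2}(A)\times\mathcal{G}_{s,\log,0}(A)$$ and $$(u(t),u'(t))\notin\mathcal{G}_{-S,\log,1/2}(A)\times\mathcal{G}_{-S,\log,0}(A)\qquad\forall t>0$$ is residual in $\mathcal{PS}(\mu_1,\mu_2,\alpha,H)$ with respect to the distance induced by the uniform ($L^\infty$) norm.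
   Context: A nonnegative discrete multiplication operator $A$ on a Hilbert space $\mathcal{H}$ is given by an orthonormal basis $\{e_i\}_{i\in\mathbb{N}}$ and a nondecreasing sequence $\{\lambda_i\}$ of nonnegative reals with $Ae_i=\lambda_i^2e_i$; it is unbounded if $\lambda_i\to+\infty$. Elements are identified with coefficient sequences $u=\{u_i\}$, and the following spaces of sequences are used ($\beta\in\mathbb{R}$, $s,S>0$): - $u\in\mathcal{G}_{s,\log,\beta}(A)$ iff $\sum_i u_i^2(1+\lambda_i)^{4\beta}\exp\!\big(2\lambda_i^{1/s}/\log(2+\lambda_i)\big)<+\infty$; - $u\in\mathcal{G}_{-S,\log,\beta}(A)$ iff $\sum_i u_i^2(1+\lambda_i)^{4\beta}\exp\!\big(-2\lambda_i^{1/S}/\log(2+\lambda_i)\big)<+\infty$. For $0<\mu_1<\mu_2$, $\alpha\in(0,1)$, $H>0$, $\mathcal{PS}(\mu_1,\mu_2,\alpha,H)$ is the set of functions $c:[0,+\infty)\to[0,+\infty)$ with $\mu_1\le c(t)\le\mu_2$ for all $t\ge0$ and $|c(t)-c(s)|\le H|t-s|^\alpha$ for all $t,s\ge 0$; it is a complete metric space with the uniform distance. A subset of a complete metric space is residual if it contains a countable intersection of open dense sets. A very weak solution of $u''+2\delta A^\sigma u'+c(t)Au=0$ is a sequence $\{u_i(t)\}$ of $C^2$ functions on $[0,+\infty)$ with $u_i''(t)+2\delta\lambda_i^{2\sigma}u_i'(t)+c(t)\lambda_i^2u_i(t)=0$ for every $i$ and $t\ge 0$; one writes $u(t)=\{u_i(t)\}$,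 $u'(t)=\{u_i'(t)\}$. *)

(* Defs.v *)
From Stdlib Require Import Reals Lra.
Open Scope R_scope.

(* x^y for x >= 0, y > 0, with the convention 0^y = 0. *)
Definition powR (x y : R) : R := if Rle_dec x 0 then 0 else Rpower x y.

Definition summable (f : nat -> R) : Prop := exists l, infinite_sum f l.

(* Discrete multiplication operator data: Ae_i = lam_i^2 e_i, lam nonneg,
   nondecreasing, tending to +infinity (unbounded). *)
Definition unbounded_dmo (lam : nat -> R) : Prop :=
  (forall i, 0 <= lam i) /\ (forall i, lam i <= lam (S i)) /\ cv_infty lam.

Definition G_pos (lam : nat -> R) (s beta : R) (u : nat -> R) : Prop :=
  summable (fun i => (u i)^2 * Rpower (1 + lam i) (4 * beta)
                     * exp (2 * powR (lam i) (1 / s) / ln (2 + lam i))).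

Definition G_neg (lam : nat -> R) (Sx beta : R) (u : nat -> R) : Prop :=
  summable (fun i => (u i)^2 * Rpower (1 + lam i) (4 * beta)
                     * exp (- (2 * powR (lam i) (1 / Sx) / ln (2 + lam i)))).

Definition deriv_nonneg (f f' : R -> R) : Prop :=
  forall t, 0 <= t -> forall eps, 0 < eps -> exists del, 0 < del /\
    forall h, h <> 0 -> Rabs h < del -> 0 <= t + h ->
      Rabs ((f (t + h) - f t) / h - f' t) < eps.

Definition cont_nonneg (f : R -> R) : Prop :=
  forall t, 0 <= t -> forall eps, 0 < eps -> exists del, 0 < del /\
    forall t', 0 <= t' -> Rabs (t' - t) < del -> Rabs (f t' - f t) < eps.

(* The space PS(mu1,mu2,alpha,H); functions c : [0,+oo) -> R represented as
   R -> R whose values on t < 0 are irrelevant. *)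
Definition PS (mu1 mu2 alpha H : R) (c : R -> R) : Prop :=
  (forall t, 0 <= t -> mu1 <= c t <= mu2) /\
  (forall t s, 0 <= t -> 0 <= s -> Rabs (c t - c s) <= H * powR (Rabs (t - s)) alpha).

Definition unif_close (c c' : R -> R) (eps : R) : Prop :=
  forall t, 0 <= t -> Rabs (c t - c' t) <= eps.

Definition open_in (X U : (R -> R) -> Prop) : Prop :=
  forall c, X c -> U c -> exists eps, 0 < eps /\
    forall c', X c' -> unif_close c c' eps -> U c'.

Definition dense_in (X U : (R -> R) -> Prop) : Prop :=
  forall c, X c -> forall eps, 0 < eps -> exists c', X c' /\ U c' /\ unif_close c c' eps.

Definition residual_in (X T : (R -> R) -> Prop) : Prop :=
  exists U : nat -> ((R -> R) -> Prop),
    (forall n, open_in X (U n)) /\ (forall n, dense_in X (U n)) /\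
    (forall c, X c -> (forall n, U n c) -> T c).

Definition very_weak_sol (lam : nat -> R) (delta sigma : R) (c : R -> R)
    (u v : nat -> R -> R) : Prop :=
  forall i, exists w : R -> R,
    deriv_nonneg (u i) (v i) /\ deriv_nonneg (v i) w /\ cont_nonneg w /\
    forall t, 0 <= t ->
      w t + 2 * delta * powR (lam i) (2 * sigma) * v i t + c t * (lam i)^2 * u i t = 0.

Definition bad_speeds (lam : nat -> R) (mu1 mu2 alpha H delta sigma s Sx : R)
    (c : R -> R) : Prop :=
  PS mu1 mu2 alpha H c /\
  exists u v : nat -> R -> R,
    very_weak_sol lam delta sigma c u v /\
    G_pos lam s (1/2) (fun i => u i 0) /\ G_pos lam s 0 (fun i => v i 0) /\
    forall t, 0 < t ->
      ~ (G_neg lam Sx (1/2) (fun i => u i t) /\ G_neg lam Sx 0 (fun i => v i t)).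

(* Main.v *)
Require Import Defs.
From Stdlib Require Import Reals Lra Lia Psatz ClassicalEpsilon.
From Coquelicot Require Import Coquelicot.
Open Scope R_scope.

(* A speed oscillating at twice the frequency of the i-th component, with amplitude of order
   lam_i^(-alpha), is still alpha-Hoelder, and by parametric resonance makes that component grow like
   exp(k lam_i^(1-alpha) t); the bound on delta says that this growth beats the damping.

   A speed c is first moved into the interior of the space and averaged into a C^2 function m. With
   Phi' = lam sqrt m, D = delta lam^(1-alpha), B = b lam^(1-alpha), the function
   u = m^(-1/4) exp(- D t + B int_0^t sin^2 Phi) sin Phi solves the damped equation exactly for an
   explicit speed, close to m when lam is large. At every fixed t > 0 its energy exceeds
   exp(4 lam^(1-alpha) / log(2 + lam)), and by Gronwall's inequality this persists for all speeds in a
   small ball. So for every n the speeds that activate, robustly, some component of index at least n on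
   the time interval [1/(n+1), n+1] form a dense open set. For a speed in all these sets, a solution
   whose only nonzero components are sparse activated ones has the required data and norms. *)

(** * Regularization of propagation speeds *)

(** Two constraints on the amplitude b meet in the constant 32. For large lam the perturbation of m
    oscillates by at most 12 b sqrt mu2 lam^(-alpha), with slope at most 12 b mu2 lam^(1-alpha);
    interpolation gives the Hoelder constant 12 b mu2^((1+alpha)/2), independent of lam. Leaving a
    quarter of H to m asks that this be at most 3H/4, whence b = H / (16 mu2^((1+alpha)/2)). Since
    sin^2 has mean 1/2, the exponent grows at the rate (b/2 - delta) lam^(1-alpha): damping with 2
    sigma = 1 - alpha has the same order as the growth, and loses when delta < b/2.

    As 1/s = 1 - alpha, the spaces carry the weights exp(2 phi) and exp(-2 phi) with phi =
    lam^(1-alpha) / log(2 + lam). Data of size exp(-phi) lose exp(-2 phi) in the squared norm and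
    the weight at time t loses as much again; hence the threshold exp(4 phi). The logarithm makes
    phi negligible against lam^(1-alpha) t for each t > 0, so the growth wins at arbitrarily small
    times. An extra factor 4^n asked of activated components pays for the summable weights 4^(-n)
    put on the data. *)

Lemma powR_pos_eq x y : 0 < x -> powR x y = Rpower x y.
Proof. intros. unfold powR. destruct (Rle_dec x 0); [lra|reflexivity]. Qed.

Lemma powR_nonneg x y : 0 <= powR x y.
Proof.
  unfold powR. destruct (Rle_dec x 0); [lra|]. left; apply exp_pos.
Qed.

Lemma powR_le x y a : 0 < a -> x <= y -> powR x a <= powR y a.
Proof.
  intros Ha Hxy. unfold powR at 1. destruct (Rle_dec x 0) as [|n].
  - apply powR_nonneg.
  - rewrite powR_pos_eq by lra. apply Rle_Rpower_l; lra.
Qed.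

Lemma powR_small a e : 0 < a -> 0 < e ->
  exists eta, 0 < eta /\ forall x, x <= eta -> powR x a <= e.
Proof.
  intros Ha He. exists (Rpower e (/ a)). split; [apply exp_pos|]. intros x Hx.
  apply Rle_trans with (1 := powR_le _ _ a Ha Hx).
  rewrite powR_pos_eq by apply exp_pos. rewrite Rpower_mult.
  replace (/ a * a) with 1 by (field; lra). rewrite Rpower_1; lra.
Qed.

(** Split X as X^(1-a) X^a and use one bound for each factor. With K1 of order lam^(-alpha), K2 of
    order lam^(1-alpha) and a = alpha, the powers of lam cancel. *)
Lemma holder_interpolation a X K1 K2 d : 0 < a < 1 -> 0 < K1 -> 0 < K2 -> 0 <= d ->
  X <= K1 -> X <= K2 * d -> X <= Rpower K1 (1 - a) * Rpower K2 a * powR d a.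
Proof.
  intros Ha HK1 HK2 Hd H1 H2.
  assert (Hnn : 0 <= Rpower K1 (1 - a) * Rpower K2 a * powR d a).
  { apply Rmult_le_pos; [|apply powR_nonneg].
    apply Rmult_le_pos; left; apply exp_pos. }
  destruct (Rle_or_lt X 0) as [|HX]; [lra|].
  assert (0 < d) by (destruct (Req_dec d 0); [subst; lra|lra]).
  rewrite powR_pos_eq by lra.
  rewrite Rmult_assoc, Rpower_mult_distr by lra.
  replace X with (Rpower X (1 - a) * Rpower X a) at 1.
  2:{ rewrite <- Rpower_plus. replace (1 - a + a) with 1 by ring. apply Rpower_1; lra. }
  apply Rmult_le_compat; try (left; apply exp_pos); apply Rle_Rpower_l; lra.
Qed.

Lemma continuous_of_modulus (f om : R -> R) :
  (forall e, 0 < e -> exists eta, 0 < eta /\ forall x, x <= eta -> om x <= e) ->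
  (forall t s, Rabs (f t - f s) <= om (Rabs (t - s))) ->
  forall t, continuous f t.
Proof.
  intros Hom Hf t. apply continuity_pt_filterlim. intros e He.
  destruct (Hom (e / 2)) as [eta [Heta H]]; [lra|].
  exists eta. split; [exact Heta|]. intros x [_ Hx].
  unfold dist, R_met, Rdist in *; simpl in *.
  unfold R_dist in *.
  apply Rle_lt_trans with (1 := Hf x t).
  apply Rle_lt_trans with (e / 2); [apply H; lra|lra].
Qed.

Lemma is_derive_continuous (f : R -> R) t l : is_derive f t l -> continuous f t.
Proof. intros H. apply @ex_derive_continuous. exists l; exact H. Qed.

Lemma lipschitz_of_derive (f f' : R -> R) K :
  (forall t, is_derive f t (f' t)) -> (forall t, Rabs (f' t) <= K) ->
  forall t s, Rabs (f t - f s) <= K * Rabs (t - s).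
Proof.
  intros Hd HK t s.
  destruct (MVT_gen f s t f') as [x [_ Hx]].
  - intros x _; apply Hd.
  - intros x _. apply continuity_pt_filterlim, is_derive_continuous with (1 := Hd x).
  - rewrite Hx, Rabs_mult. apply Rmult_le_compat_r; [apply Rabs_pos|apply HK].
Qed.

Lemma is_derive_diff_quot (F F' : R -> R) tau t : 
  (forall x, is_derive F x (F' x)) ->
  is_derive (fun t => (F (t + tau) - F t) / tau) t ((F' (t + tau) - F' t) / tau).
Proof.
  intros HF. apply is_derive_ext with (fun t => / tau * (F (t + tau) - F t)).
  { intros x. apply Rmult_comm. }
  evar_last.
  - apply is_derive_scal. apply @is_derive_minus; [|apply HF].
    apply (is_derive_comp F (fun t => t + tau)); [apply HF|].
    auto_derive; [exact I|reflexivity].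
  - unfold scal, minus, plus, opp; simpl; unfold mult; simpl. unfold Rdiv. ring.
Qed.

(** F is the mean of [f] over [t, t + tau]. A mean of translates keeps the bounds and the modulus of
    continuity with unchanged constants, and its derivative is a difference quotient of [f]: each
    averaging gains one derivative at no cost in the Hoelder constant. *)
Lemma forward_average (f om : R -> R) lo hi tau :
  (forall t, continuous f t) -> (forall t, lo <= f t <= hi) ->
  (forall x y, x <= y -> om x <= om y) ->
  (forall t s, Rabs (f t - f s) <= om (Rabs (t - s))) -> 0 < tau ->
  exists F : R -> R,
    (forall t, is_derive F t ((f (t + tau) - f t) / tau)) /\
    (forall t, lo <= F t <= hi) /\
    (forall t s, Rabs (F t - F s) <= om (Rabs (t - s))) /\
    (forall t, Rabs (F t - f t) <= om tau).
Proof.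
  intros Hc Hb Hmon Hom Htau.
  assert (Hi : forall a b, ex_RInt f a b).
  { intros a b. apply @ex_RInt_continuous. intros; apply Hc. }
  pose (P := fun t => RInt f 0 t).
  assert (HP : forall t, is_derive P t (f t)).
  { intros t. apply is_derive_RInt with 0; [|apply Hc].
    apply filter_forall. intros x. apply @RInt_correct, Hi. }
  assert (Hsh : forall t (k : R -> R) , k = (fun x => f (t + x)) -> ex_RInt k 0 tau
     /\ RInt k 0 tau = P (t + tau) - P t).
  { intros t k ->. 
    assert (Hk : is_RInt (fun x => f (t + x)) 0 tau (P (t + tau) - P t)).
    { replace (P (t + tau) - P t) with (minus (P (t + tau)) (P (t + 0))).
      2:{ rewrite Rplus_0_r. reflexivity. }
      apply (is_RInt_derive (fun x => P (t + x))).
      - intros x _. evar_last. 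
        + apply is_derive_comp. apply HP. auto_derive; [exact I|reflexivity].
        + unfold scal; simpl; unfold mult; simpl. ring.
      - intros x _. apply continuous_comp; [|apply Hc].
        apply (is_derive_continuous _ _ 1). auto_derive; [exact I|ring]. }
    split; [eexists; exact Hk|apply is_RInt_unique, Hk]. }
  assert (Hconst : forall k, RInt (fun _ => k) 0 tau = tau * k).
  { intros k. rewrite RInt_const. unfold scal; simpl; unfold mult; simpl. ring. }
  assert (Habs : forall (k : R -> R) M, ex_RInt k 0 tau -> (forall x, 0 < x < tau -> Rabs (k x) <= M) ->
     Rabs (RInt k 0 tau / tau) <= M).
  { intros k M Hk HM. unfold Rdiv. rewrite Rabs_mult, (Rabs_pos_eq (/ tau)).
    2:{ left; apply Rinv_0_lt_compat, Htau. }
    apply Rmult_le_reg_r with tau; [lra|]. rewrite Rmult_assoc, Rinv_l by lra.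
    rewrite Rmult_1_r.
    assert (Hup : RInt k 0 tau <= tau * M).
    { rewrite <- Hconst. apply RInt_le; [lra|exact Hk|apply ex_RInt_const|].
      intros x Hx. specialize (HM x Hx). apply Rabs_le_between in HM. lra. }
    assert (Hlo : tau * - M <= RInt k 0 tau).
    { rewrite <- Hconst. apply RInt_le; [lra|apply ex_RInt_const|exact Hk|].
      intros x Hx. specialize (HM x Hx). apply Rabs_le_between in HM. lra. }
    apply Rabs_le_between. lra. }
  assert (Hminus : forall k1 k2, ex_RInt k1 0 tau -> ex_RInt k2 0 tau ->
     RInt (fun x => k1 x - k2 x) 0 tau = RInt k1 0 tau - RInt k2 0 tau).
  { intros k1 k2 H1 H2. apply (RInt_minus k1 k2 0 tau H1 H2). }
  assert (Hdm : forall a b, a / tau - b / tau = (a - b) / tau) by (intros; unfold Rdiv; ring).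
  exists (fun t => (P (t + tau) - P t) / tau). split; [|split; [|split]].
  - intros t. apply is_derive_diff_quot, HP.
  - intros t. destruct (Hsh t _ eq_refl) as [Hk <-].
    split; apply Rmult_le_reg_r with tau; try lra;
      unfold Rdiv; rewrite Rmult_assoc, Rinv_l, Rmult_1_r by lra.
    + rewrite Rmult_comm, <- Hconst. apply RInt_le; [lra|apply ex_RInt_const|exact Hk|].
      intros; apply Hb.
    + rewrite (Rmult_comm hi), <- Hconst. apply RInt_le; [lra|exact Hk|apply ex_RInt_const|].
    intros; apply Hb.
  - intros t s. destruct (Hsh t _ eq_refl) as [Hk <-]. destruct (Hsh s _ eq_refl) as [Hk' <-].
    rewrite Hdm, <- (Hminus _ _ Hk Hk').
    apply Habs; [exact (ex_RInt_minus _ _ _ _ Hk Hk')|].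
    intros x _. apply Rle_trans with (1 := Hom _ _). right. f_equal. f_equal. ring.
  - intros t. destruct (Hsh t _ eq_refl) as [Hk <-].
    replace (f t) with (RInt (fun _ => f t) 0 tau / tau) by (rewrite Hconst; field; lra).
    assert (Hk' := ex_RInt_const 0 tau (f t)).
    rewrite Hdm, <- (Hminus _ _ Hk Hk').
    apply Habs; [exact (ex_RInt_minus _ _ _ _ Hk Hk')|].
    intros x Hx. apply Rle_trans with (1 := Hom _ _). apply Hmon.
    replace (t + x - t) with x by ring. rewrite Rabs_pos_eq; lra.
Qed.

(** Contracting [c] towards the midpoint of [mu1, mu2] leaves room in the bounds and in the Hoelder
    constant; averages then smooth it. Three of them make the second derivative Lipschitz, as the
    explicit speed contains it through [logder']. *)
Lemma PS_regularization mu1 mu2 alpha H c eps :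
  0 < mu1 -> mu1 < mu2 -> 0 < alpha < 1 -> 0 < H -> PS mu1 mu2 alpha H c -> 0 < eps ->
  exists (m m1 m2 : R -> R) (K theta : R),
    0 < theta /\
    (forall t, is_derive m t (m1 t)) /\ (forall t, is_derive m1 t (m2 t)) /\
    (forall t, Rabs (m1 t) <= K) /\ (forall t, Rabs (m2 t) <= K) /\
    (forall t s, Rabs (m2 t - m2 s) <= K * Rabs (t - s)) /\
    (forall t, mu1 + theta <= m t <= mu2 - theta) /\
    (forall t s, Rabs (m t - m s) <= (H - theta) * powR (Rabs (t - s)) alpha) /\
    unif_close c m eps.
Proof.
  intros Hmu1 Hmu Ha HH [Hcb Hch] Heps.
  (* The contraction moves [c] by at most eps / 4, and each of the three averages by at most eps /
     12, by the choice of [tau] below. *)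
  set (th := Rmin (1 / 2) (eps / (4 * (mu2 - mu1)))).
  assert (Hth : 0 < th <= 1 / 2).
  { split; [|apply Rmin_l]. apply Rmin_pos; [lra|]. apply Rdiv_lt_0_compat; lra. }
  assert (Hth' : th * (mu2 - mu1) <= eps / 4).
  { apply Rle_trans with (eps / (4 * (mu2 - mu1)) * (mu2 - mu1)).
    - apply Rmult_le_compat_r; [lra|apply Rmin_r].
    - right; field; lra. }
  (* Extending [c] by its value at 0 to negative times preserves the Hoelder bound, since [Rmax 0]
     does not increase distances. *)
  set (f0 := fun t => (1 - th) * c (Rmax 0 t) + th * ((mu1 + mu2) / 2)).
  set (kap := th * ((mu2 - mu1) / 2)).
  assert (Hkap : 0 < kap) by (apply Rmult_lt_0_compat; lra).
  assert (Hb0 : forall t, mu1 + kap <= f0 t <= mu2 - kap).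
  { intros t. destruct (Hcb (Rmax 0 t) (Rmax_l _ _)). unfold f0, kap. split; nra. }
  set (om := fun x => (1 - th) * H * powR x alpha).
  assert (Hc1 : 0 < (1 - th) * H) by (apply Rmult_lt_0_compat; lra).
  assert (Hmon : forall x y, x <= y -> om x <= om y).
  { intros x y Hxy. apply Rmult_le_compat_l; [lra|]. apply powR_le; lra. }
  assert (Hsmall : forall e, 0 < e -> exists eta, 0 < eta /\ forall x, x <= eta -> om x <= e).
  { intros e He. destruct (powR_small alpha (e / ((1 - th) * H))) as [eta [Heta Hx]];
      [lra|apply Rdiv_lt_0_compat; lra|].
    exists eta. split; [exact Heta|]. intros x Hle. unfold om.
    apply Rle_trans with ((1 - th) * H * (e / ((1 - th) * H))).
    - apply Rmult_le_compat_l; [lra|auto].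
    - right; field; lra. }
  assert (Hh0 : forall t s, Rabs (f0 t - f0 s) <= om (Rabs (t - s))).
  { intros t s. unfold f0, om.
    replace (_ - _) with ((1 - th) * (c (Rmax 0 t) - c (Rmax 0 s))) by ring.
    rewrite Rabs_mult, (Rabs_pos_eq (1 - th)), Rmult_assoc by lra.
    apply Rmult_le_compat_l; [lra|].
    apply Rle_trans with (1 := Hch _ _ (Rmax_l _ _) (Rmax_l _ _)).
    apply Rmult_le_compat_l; [lra|]. apply powR_le; [lra|].
    unfold Rmax; destruct (Rle_dec 0 t), (Rle_dec 0 s); unfold Rabs;
      repeat destruct Rcase_abs; lra. }
  destruct (Hsmall (eps / 12)) as [tau [Htau Hts]]; [lra|].
  specialize (Hts tau (Rle_refl _)).
  assert (Hc0 := continuous_of_modulus _ _ Hsmall Hh0).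
  destruct (forward_average f0 om _ _ tau Hc0 Hb0 Hmon Hh0 Htau) as (F1 & D1 & B1 & M1 & E1).
  destruct (forward_average F1 om _ _ tau (fun t => is_derive_continuous _ _ _ (D1 t)) B1 Hmon M1 Htau)
    as (F2 & D2 & B2 & M2 & E2).
  destruct (forward_average F2 om _ _ tau (fun t => is_derive_continuous _ _ _ (D2 t)) B2 Hmon M2 Htau)
    as (m & D3 & B3 & M3 & E3).
  set (W := mu2 / tau). 
  assert (HW : 0 < W) by (apply Rdiv_lt_0_compat; lra).
  assert (Hquot : forall a b k, Rabs (a - b) <= k -> Rabs ((a - b) / tau) <= k / tau).
  { intros a b k Hk. unfold Rdiv. rewrite Rabs_mult, (Rabs_pos_eq (/ tau)).
    2:{ left; apply Rinv_0_lt_compat, Htau. }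
    apply Rmult_le_compat_r; [left; apply Rinv_0_lt_compat, Htau|exact Hk]. }
  assert (Hosc : forall f : R -> R, (forall t, mu1 + kap <= f t <= mu2 - kap) ->
     forall t s, Rabs (f t - f s) <= mu2).
  { intros f Hf t s. destruct (Hf t), (Hf s). apply Rabs_le_between. lra. }
  assert (L1 : forall t s, Rabs (F1 t - F1 s) <= W * Rabs (t - s)).
  { apply (lipschitz_of_derive _ _ _ D1). intros t. apply Hquot, Hosc, Hb0. }
  set (g1 := fun t => (F1 (t + tau) - F1 t) / tau) in *.
  assert (Bg1 : forall t, Rabs (g1 t) <= W) by (intros; apply Hquot, Hosc, B1).
  assert (Lg1 : forall t s, Rabs (g1 t - g1 s) <= 2 * W / tau * Rabs (t - s)).
  { intros t s. unfold g1.
    replace (_ - _) with (((F1 (t + tau) - F1 (s + tau)) - (F1 t - F1 s)) / tau)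
      by (unfold Rdiv; ring).
    apply Rle_trans with ((2 * W * Rabs (t - s)) / tau); [|right; unfold Rdiv; ring].
    apply Hquot. apply Rle_trans with (1 := Rabs_triang _ _). rewrite Rabs_Ropp.
    specialize (L1 t s) as X1. specialize (L1 (t + tau) (s + tau)) as X2.
    replace (t + tau - (s + tau)) with (t - s) in X2 by ring. lra. }
  set (m1 := fun t => (F2 (t + tau) - F2 t) / tau) in *.
  set (g2 := fun t => (g1 (t + tau) - g1 t) / tau).
  assert (Dm1 : forall t, is_derive m1 t (g2 t)).
  { intros t. apply is_derive_diff_quot, D2. }
  set (K := W + 2 * W / tau + 4 * W / tau / tau).
  assert (HWt : 0 < W / tau) by (apply Rdiv_lt_0_compat; lra).
  assert (HWtt : 0 < W / tau / tau) by (apply Rdiv_lt_0_compat; lra).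
  exists m, m1, g2, K, (Rmin kap (th * H)).
  assert (Rmin kap (th * H) <= kap) by apply Rmin_l.
  assert (Rmin kap (th * H) <= th * H) by apply Rmin_r.
  split; [|split; [|split; [|split; [|split; [|split; [|split; [|split]]]]]]].
  - apply Rmin_pos; [lra|]. apply Rmult_lt_0_compat; lra.
  - exact D3.
  - exact Dm1.
  - intros t. apply Rle_trans with W; [apply Hquot, Hosc, B2|]. unfold K. lra.
  - intros t. apply Rle_trans with (2 * W / tau); [|unfold K; lra].
    apply Hquot. apply Rle_trans with (1 := Rabs_triang _ _). rewrite Rabs_Ropp.
    assert (X1 := Bg1 t). assert (X2 := Bg1 (t + tau)). lra.
  - intros t s. unfold g2.
    replace (_ - _) with (((g1 (t + tau) - g1 (s + tau)) - (g1 t - g1 s)) / tau)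
      by (unfold Rdiv; ring).
    apply Rle_trans with ((4 * W / tau * Rabs (t - s)) / tau).
    + apply Hquot. apply Rle_trans with (1 := Rabs_triang _ _). rewrite Rabs_Ropp.
      specialize (Lg1 t s) as X1. specialize (Lg1 (t + tau) (s + tau)) as X2.
      replace (t + tau - (s + tau)) with (t - s) in X2 by ring. lra.
    + replace (4 * W / tau * Rabs (t - s) / tau) with (4 * W / tau / tau * Rabs (t - s))
        by (unfold Rdiv; ring).
      apply Rmult_le_compat_r; [apply Rabs_pos|]. unfold K. lra.
  - intros t. destruct (B3 t). lra.
  - intros t s. apply Rle_trans with (1 := M3 t s). unfold om.
    apply Rmult_le_compat_r; [apply powR_nonneg|]. lra.
  - intros t Ht.
    assert (X1 := E1 t). assert (X2 := E2 t). assert (X3 := E3 t).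
    assert (X4 : Rabs (c t - f0 t) <= eps / 4).
    { unfold f0. rewrite Rmax_right by exact Ht. destruct (Hcb t Ht).
      apply Rabs_le_between. split; nra. }
    apply Rabs_le_between in X1. apply Rabs_le_between in X2.
    apply Rabs_le_between in X3. apply Rabs_le_between in X4.
    apply Rabs_le_between. lra.
Qed.

Lemma exp_le_exp x y : x <= y -> exp x <= exp y.
Proof. intros [Hxy| ->]; [left; apply exp_increasing, Hxy|right; reflexivity]. Qed.

(** * Existence for the linear oscillator *)

Lemma ex_RInt_cont (f : R -> R) a b : (forall t, continuous f t) -> ex_RInt f a b.
Proof. intros Hf. apply @ex_RInt_continuous. intros; apply Hf. Qed.

Lemma is_derive_primitive (f : R -> R) a t :
  (forall t, continuous f t) -> is_derive (fun t => RInt f a t) t (f t).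
Proof.
  intros Hf. apply is_derive_RInt with a; [|apply Hf].
  apply filter_forall. intros x. apply @RInt_correct, ex_RInt_cont, Hf.
Qed.

Lemma continuous_primitive (f : R -> R) a t :
  (forall t, continuous f t) -> continuous (fun t => RInt f a t) t.
Proof. intros Hf. exact (is_derive_continuous _ _ _ (is_derive_primitive f a t Hf)). Qed.

(** For functions measured against exp(K t), each integration gains a factor 1 / K; a large K makes
    the Volterra operator a contraction on the whole half line at once. *)
Lemma RInt_exp_bound (g : R -> R) B K t : 
  (forall t, continuous g t) -> 0 <= B -> 0 < K -> 0 <= t ->
  (forall s, 0 <= s -> Rabs (g s) <= B * exp (K * s)) ->
  Rabs (RInt g 0 t) <= B / K * exp (K * t).
Proof.
  intros Hg HB HK Ht Hgb.
  assert (HE : is_RInt (fun s => B * exp (K * s)) 0 t (B / K * exp (K * t) - B / K * exp (K * 0))).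
  { apply (is_RInt_derive (fun s => B / K * exp (K * s))).
    - intros x _. auto_derive; [exact I|]. field; lra.
    - intros x _. apply (is_derive_continuous _ _ (B * (K * exp (K * x)))). auto_derive; [exact I|ring]. }
  apply Rle_trans with (RInt (fun s => Rabs (g s)) 0 t).
  { apply abs_RInt_le; [exact Ht|apply ex_RInt_cont, Hg]. }
  apply Rle_trans with (B / K * exp (K * t) - B / K * exp (K * 0)).
  - rewrite <- (is_RInt_unique _ _ _ _ HE). apply RInt_le; [exact Ht| |eexists; exact HE|].
    + apply ex_RInt_cont. intros s. apply continuous_comp; [apply Hg|apply continuous_Rabs].
    + intros s Hs. apply Hgb. lra.
  - assert (0 <= B / K) by (apply Rmult_le_pos; [lra|left; apply Rinv_0_lt_compat, HK]).
    rewrite Rmult_0_r, exp_0. lra.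
Qed.

Lemma half_pow_small C e : 0 < C -> 0 < e -> exists n, C * (1 / 2) ^ n < e.
Proof.
  intros HC He. destruct (pow_lt_1_zero (1 / 2)) with (y := e / C) as [N HN].
  - rewrite Rabs_pos_eq; lra.
  - apply Rdiv_lt_0_compat; lra.
  - exists N. specialize (HN N (le_n N)). rewrite Rabs_pos_eq in HN by (apply pow_le; lra).
    replace e with (C * (e / C)) by (field; lra). apply Rmult_lt_compat_l; lra.
Qed.

Lemma continuous_Rmax0 t : continuous (Rmax 0) t.
Proof.
  apply continuous_of_modulus with (fun x => x).
  - intros e He. exists e. split; [exact He|auto].
  - intros x y. unfold Rmax; destruct (Rle_dec 0 x), (Rle_dec 0 y); unfold Rabs;
      repeat destruct Rcase_abs; lra.
Qed.

(** The Cauchy problem y'' = - q y, y(0) = 0, y'(0) = 1 amounts to y(t) = t - [volterra q y t]. *)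
Definition volterra (q f : R -> R) (t : R) : R :=
  RInt (fun s => RInt (fun r => q r * f r) 0 s) 0 t.

Section Picard.
Variables (q : R -> R) (Q : R).
Hypothesis q_cont : forall t, continuous q t.
Hypothesis q_bound : forall t, Rabs (q t) <= Q.

Let K := 1 + 2 * Q.

Lemma picard_Q_nonneg : 0 <= Q.
Proof. apply Rle_trans with (2 := q_bound 0). apply Rabs_pos. Qed.

Lemma continuous_q_mult f : (forall t, continuous f t) -> forall t, continuous (fun r => q r * f r) t.
Proof. intros Hf t. apply (continuous_mult q f); [apply q_cont|apply Hf]. Qed.

Lemma volterra_continuous f : (forall t, continuous f t) -> forall t, continuous (volterra q f) t.
Proof.
  intros Hf t. apply continuous_primitive. intros s. apply continuous_primitive, continuous_q_mult, Hf.
Qed.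

(** Two integrations divide by K^2 and [q] multiplies by at most Q; the choice K = 1 + 2 Q makes Q /
    K^2 at most 1/2. *)
Lemma volterra_bound f A t : (forall t, continuous f t) -> 0 <= A -> 0 <= t ->
  (forall s, 0 <= s -> Rabs (f s) <= A * exp (K * s)) ->
  Rabs (volterra q f t) <= A / 2 * exp (K * t).
Proof.
  intros Hf HA Ht Hb. assert (HQ := picard_Q_nonneg).
  assert (HK : 0 < K) by (unfold K; lra).
  apply Rle_trans with (Q * A / K / K * exp (K * t)).
  - apply RInt_exp_bound; try lra.
    + intros s. apply continuous_primitive, continuous_q_mult, Hf.
    + apply Rmult_le_pos; [apply Rmult_le_pos; lra|left; apply Rinv_0_lt_compat, HK].
    + intros s Hs. apply RInt_exp_bound; try lra.
      * apply continuous_q_mult, Hf.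
      * apply Rmult_le_pos; lra.
      * intros r Hr. rewrite Rabs_mult, Rmult_assoc.
        apply Rmult_le_compat; try apply Rabs_pos; auto.
  - apply Rmult_le_compat_r; [left; apply exp_pos|].
    apply Rmult_le_reg_r with (K * K); [nra|].
    replace (Q * A / K / K * (K * K)) with (Q * A) by (field; lra).
    unfold K. nra.
Qed.

Lemma volterra_minus f g t : (forall t, continuous f t) -> (forall t, continuous g t) ->
  volterra q (fun s => f s - g s) t = volterra q f t - volterra q g t.
Proof.
  intros Hf Hg. unfold volterra.
  rewrite <- (RInt_minus (fun s => RInt (fun r => q r * f r) 0 s) (fun s => RInt (fun r => q r * g r) 0 s)).
  - apply RInt_ext. intros s _.
    rewrite <- (RInt_minus (fun r => q r * f r) (fun r => q r * g r)).
    + apply RInt_ext. intros r _. apply Rmult_minus_distr_l.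
    + apply ex_RInt_cont, continuous_q_mult, Hf.
    + apply ex_RInt_cont, continuous_q_mult, Hg.
  - apply ex_RInt_cont. intros s. apply continuous_primitive, continuous_q_mult, Hf.
  - apply ex_RInt_cont. intros s. apply continuous_primitive, continuous_q_mult, Hg.
Qed.

(** The clamp [Rmax 0] makes the iterates continuous on all of R, although the contraction estimate
    is available only for t >= 0. *)
Fixpoint picard (n : nat) (t : R) : R :=
  match n with
  | O => 0
  | S n => Rmax 0 t - volterra q (picard n) (Rmax 0 t)
  end.

Lemma picard_continuous n t : continuous (picard n) t.
Proof.
  revert t. induction n as [|n IH]; intros t; simpl; [apply continuous_const|].
  apply (continuous_minus (Rmax 0) (fun t => volterra q (picard n) (Rmax 0 t))).
  - apply continuous_Rmax0.
  - apply continuous_comp; [apply continuous_Rmax0|]. apply volterra_continuous, IH.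
Qed.

Lemma picard_step n t : 0 <= t -> Rabs (picard (S n) t - picard n t) <= (1 / 2) ^ n * exp (K * t).
Proof.
  revert t. induction n as [|n IH]; intros t Ht.
  - simpl. rewrite Rmax_right by exact Ht.
    assert (E : volterra q (fun _ => 0) t = 0).
    { unfold volterra. rewrite (RInt_ext _ (fun _ => 0)).
      - rewrite RInt_const. unfold scal; simpl; unfold mult; simpl; ring.
      - intros x _. rewrite (RInt_ext _ (fun _ => 0)) by (intros; apply Rmult_0_r).
        rewrite RInt_const. unfold scal; simpl; unfold mult; simpl; ring. }
    change (picard 0) with (fun _ : R => 0). rewrite E.
    assert (HQ := picard_Q_nonneg). 
    rewrite Rabs_pos_eq by lra. assert (X := exp_ineq1_le (K * t)).
    unfold K in *. assert (0 <= Q * t) by (apply Rmult_le_pos; lra). lra.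
  - replace (picard (S (S n)) t - picard (S n) t)
      with (- volterra q (fun s => picard (S n) s - picard n s) t).
    2:{ rewrite volterra_minus by apply picard_continuous.
        change (picard (S (S n)) t) with (Rmax 0 t - volterra q (picard (S n)) (Rmax 0 t)).
        change (picard (S n) t) with (Rmax 0 t - volterra q (picard n) (Rmax 0 t)).
        rewrite Rmax_right by exact Ht. ring. }
    rewrite Rabs_Ropp. simpl pow.
    replace (1 / 2 * (1 / 2) ^ n) with ((1 / 2) ^ n / 2) by field.
    apply volterra_bound; auto.
    + intros s. apply (continuous_minus (picard (S n)) (picard n)); apply picard_continuous.
    + apply pow_le; lra.
Qed.

Lemma picard_cauchy n k t : 0 <= t ->
  Rabs (picard (n + k) t - picard n t) <= 2 * (1 / 2) ^ n * exp (K * t).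
Proof.
  intros Ht. 
  (* Keeping the tail of the geometric series makes the induction on [k] telescope. *)
  enough (Rabs (picard (n + k) t - picard n t) <= (2 * (1 / 2) ^ n - 2 * (1/2)^(n + k)) * exp (K * t)).
  { assert (0 <= (1 / 2) ^ (n + k)) by (apply pow_le; lra). assert (0 < exp (K * t)) by apply exp_pos. nra. }
  induction k as [|k IH].
  - rewrite Nat.add_0_r, Rminus_diag, Rabs_R0. lra.
  - replace (n + S k)%nat with (S (n + k)) by lia.
    replace (picard (S (n + k)) t - picard n t) with
      ((picard (S (n + k)) t - picard (n + k) t) + (picard (n + k) t - picard n t)) by ring.
    apply Rle_trans with (1 := Rabs_triang _ _).
    assert (X := picard_step (n + k) t Ht). simpl pow. lra.
Qed.

Definition picard_limit (t : R) : R := real (Lim_seq (fun n => picard n t)).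

Lemma picard_limit_bound n t :
  Rabs (picard_limit t - picard n t) <= 2 * (1 / 2) ^ n * exp (K * Rmax 0 t).
Proof.
  assert (Hmax : forall n, picard n t = picard n (Rmax 0 t)).
  { intros m. destruct m as [|m]; [reflexivity|]. simpl.
    rewrite (Rmax_right 0 (Rmax 0 t)) by apply Rmax_l. reflexivity. }
  assert (HE := exp_pos (K * Rmax 0 t)). set (E := exp (K * Rmax 0 t)) in *.
  assert (HC : forall n k, Rabs (picard (n + k) t - picard n t) <= 2 * (1 / 2) ^ n * E).
  { intros m k. rewrite (Hmax m), (Hmax (m + k)%nat). apply picard_cauchy, Rmax_l. }
  (* [Lim_seq] is total and [real] sends an infinite limit to 0; the Cauchy estimate shows that the
     limit is genuine. *)
  assert (Hlim : is_lim_seq (fun n => picard n t) (picard_limit t)).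
  { apply Lim_seq_correct'. apply ex_lim_seq_cauchy_corr. intros e.
    destruct (pow_lt_1_zero (1 / 2)) with (y := e / (4 * E)) as [N HN].
    - rewrite Rabs_pos_eq; lra.
    - apply Rdiv_lt_0_compat; [apply cond_pos|lra].
    - exists N. intros n1 n2 H1 H2.
      assert (X1 := HC N (n1 - N)%nat). assert (X2 := HC N (n2 - N)%nat).
      replace (N + (n1 - N))%nat with n1 in X1 by lia.
      replace (N + (n2 - N))%nat with n2 in X2 by lia.
      specialize (HN N (le_n N)). rewrite Rabs_pos_eq in HN by (apply pow_le; lra).
      assert (X3 : (1 / 2) ^ N * E < e / 4).
      { apply Rmult_lt_reg_r with (/ E); [apply Rinv_0_lt_compat, HE|].
        rewrite Rmult_assoc, Rinv_r, Rmult_1_r by lra.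
        replace (e / 4 * / E) with (e / (4 * E)) by (field; lra). exact HN. }
      apply Rabs_le_between in X1. apply Rabs_le_between in X2.
      apply Rabs_lt_between. lra. }
  change (Rbar_le (Rabs (picard_limit t - picard n t)) (2 * (1 / 2) ^ n * E)).
  apply is_lim_seq_le with (fun k => Rabs (picard (n + k) t - picard n t)) (fun _ => 2 * (1 / 2) ^ n * E).
  - apply HC.
  - apply (is_lim_seq_abs _ (picard_limit t - picard n t)).
    apply is_lim_seq_minus'; [|apply is_lim_seq_const].
    apply is_lim_seq_ext with (fun k => picard (k + n) t); [intros; f_equal; lia|].
    apply (is_lim_seq_incr_n (fun k => picard k t)), Hlim.
  - apply is_lim_seq_const.
Qed.

(** For s within distance 1 of t the weight is at most exp(K (Rmax 0 t + 1)), so the convergence is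
    uniform near t. *)
Lemma picard_limit_continuous t : continuous picard_limit t.
Proof.
  apply continuity_pt_filterlim. intros e He. assert (HQ := picard_Q_nonneg).
  set (E := exp (K * (Rmax 0 t + 1))). assert (HE : 0 < E) by apply exp_pos.
  destruct (half_pow_small (2 * E) (e / 3)) as [n Hn]; [lra|lra|].
  destruct (proj2 (continuity_pt_filterlim _ _) (picard_continuous n t) (e / 3)) as [d [Hd Hdn]]; [lra|].
  exists (Rmin d 1). split; [apply Rmin_pos; lra|]. intros x [Hx1 Hx].
  specialize (Hdn x). simpl in *. unfold Rdist in *.
  assert (Rmin d 1 <= d) by apply Rmin_l. assert (Rmin d 1 <= 1) by apply Rmin_r.
  assert (X := Hdn (conj Hx1 (Rlt_le_trans _ _ _ Hx H))).
  assert (HB : forall s, Rabs (s - t) <= 1 -> Rabs (picard_limit s - picard n s) < e / 3).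
  { intros s Hs. apply Rle_lt_trans with (1 := picard_limit_bound n s).
    apply Rle_lt_trans with (2 := Hn).
    apply Rle_trans with (2 * (1 / 2) ^ n * E); [|right; ring].
    apply Rmult_le_compat_l; [assert (0 <= (1 / 2) ^ n) by (apply pow_le; lra); lra|].
    apply exp_le_exp, Rmult_le_compat_l; [unfold K; lra|].
    apply Rabs_le_between in Hs. unfold Rmax; destruct (Rle_dec 0 s), (Rle_dec 0 t); lra. }
  assert (X1 := HB x ltac:(lra)). assert (X2 := HB t ltac:(rewrite Rminus_diag, Rabs_R0; lra)).
  apply Rabs_lt_between in X. apply Rabs_lt_between in X1. apply Rabs_lt_between in X2.
  apply Rabs_lt_between. lra.
Qed.

Lemma picard_limit_fixpoint t : 0 <= t -> picard_limit t = t - volterra q picard_limit t.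
Proof.
  intros Ht. assert (HE := exp_pos (K * t)). set (E := exp (K * t)) in *.
  apply cond_eq. intros e He.
  destruct (half_pow_small (2 * E) e) as [n Hn]; [lra|lra|].
  assert (X1 := picard_limit_bound (S n) t). rewrite Rmax_right in X1 by exact Ht. fold E in X1.
  assert (X2 : Rabs (volterra q (fun s => picard_limit s - picard n s) t) <= 2 * (1 / 2) ^ n / 2 * E).
  { apply volterra_bound; [|assert (0 <= (1 / 2) ^ n) by (apply pow_le; lra); lra|exact Ht|].
    - intros s. apply (continuous_minus picard_limit (picard n)); [apply picard_limit_continuous|apply picard_continuous].
    - intros s Hs. rewrite <- (Rmax_right 0 s) at 3 by exact Hs. apply picard_limit_bound. }
  rewrite volterra_minus in X2 by (apply picard_limit_continuous || apply picard_continuous).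
  simpl in X1. rewrite Rmax_right in X1 by exact Ht.
  apply Rabs_le_between in X1. apply Rabs_le_between in X2.
  apply Rabs_lt_between. lra.
Qed.

Lemma oscillator_exists : exists y z : R -> R, y 0 = 0 /\ z 0 = 1 /\
  (forall t, 0 <= t -> is_derive y t (z t)) /\ (forall t, 0 <= t -> is_derive z t (- (q t * y t))).
Proof.
  pose (x := picard_limit). assert (Hx := picard_limit_continuous).
  exists (fun t => t - volterra q x t), (fun t => 1 - RInt (fun r => q r * x r) 0 t).
  split; [|split; [|split]].
  - unfold volterra. rewrite RInt_point. unfold zero; simpl. ring.
  - rewrite RInt_point. unfold zero; simpl. ring.
  - intros t _. apply (is_derive_minus (fun t => t) (volterra q x)); [auto_derive; [exact I|reflexivity]|].
    apply is_derive_primitive. intros s. apply continuous_primitive, continuous_q_mult, Hx.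
  - intros t Ht. unfold x. rewrite <- (picard_limit_fixpoint t Ht).
    replace (- (q t * picard_limit t)) with (0 - q t * x t) by (unfold x; ring). fold x.
    apply (is_derive_minus (fun _ => 1) (fun t => RInt (fun r => q r * x r) 0 t)); [apply @is_derive_const|].
    apply (is_derive_primitive (fun r => q r * x r)), continuous_q_mult, Hx.
Qed.
End Picard.

(** * Energy estimates on the half line *)

Definition oscillator_solution (D lam : R) (c u v w : R -> R) : Prop :=
  deriv_nonneg u v /\ deriv_nonneg v w /\ cont_nonneg w /\
  forall t, 0 <= t -> w t + 2 * D * v t + c t * lam ^ 2 * u t = 0.

Definition energy (lam : R) (u v : R -> R) (t : R) : R := (v t) ^ 2 + lam ^ 2 * (u t) ^ 2.

Lemma is_derive_deriv_nonneg (f f' : R -> R) :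
  (forall t, 0 <= t -> is_derive f t (f' t)) -> deriv_nonneg f f'.
Proof.
  intros Hf t Ht e He. specialize (Hf t Ht). apply is_derive_Reals in Hf.
  destruct (Hf e He) as [d Hd]. exists d. split; [apply cond_pos|]. auto.
Qed.

Lemma continuous_cont_nonneg (f : R -> R) :
  (forall t, 0 <= t -> continuous f t) -> cont_nonneg f.
Proof.
  intros Hf t Ht e He.
  destruct (proj2 (continuity_pt_filterlim _ _) (Hf t Ht) e He) as [d [Hd H]].
  exists d. split; [exact Hd|]. intros t' _ Ht'.
  destruct (Req_dec t' t) as [->|Hne].
  - rewrite Rminus_diag, Rabs_R0. exact He.
  - apply (H t'). split; [split; [exact I|]|exact Ht']. auto.
Qed.

Lemma deriv_nonneg_is_derive (f f' : R -> R) t :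
  deriv_nonneg f f' -> 0 < t -> is_derive f t (f' t).
Proof.
  intros Hf Ht. apply is_derive_Reals. intros e He.
  destruct (Hf t (Rlt_le _ _ Ht) e He) as [d [Hd H]].
  assert (Hm : 0 < Rmin d t) by (apply Rmin_pos; lra).
  exists (mkposreal _ Hm). simpl. intros h Hh Hht.
  assert (Rmin d t <= d) by apply Rmin_l. assert (Rmin d t <= t) by apply Rmin_r.
  apply H; [exact Hh|lra|]. apply Rabs_lt_between in Hht. lra.
Qed.

Lemma deriv_nonneg_cont_nonneg (f f' : R -> R) : deriv_nonneg f f' -> cont_nonneg f.
Proof.
  intros Hf t Ht e He. destruct (Hf t Ht 1 Rlt_0_1) as [d [Hd H]].
  set (M := Rabs (f' t) + 1). assert (HM : 0 < M) by (assert (X := Rabs_pos (f' t)); unfold M; lra).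
  exists (Rmin d (e / M)). split; [apply Rmin_pos; [exact Hd|apply Rdiv_lt_0_compat; lra]|].
  intros t' Ht' Hd'. destruct (Req_dec t' t) as [->|Hne].
  { rewrite Rminus_diag, Rabs_R0. exact He. }
  assert (Rmin d (e / M) <= d) by apply Rmin_l. assert (Rmin d (e / M) <= e / M) by apply Rmin_r.
  specialize (H (t' - t) ltac:(lra) ltac:(lra) ltac:(lra)).
  replace (t + (t' - t)) with t' in H by ring.
  replace (f t' - f t) with ((f t' - f t) / (t' - t) * (t' - t)) by (field; lra).
  rewrite Rabs_mult.
  assert (Hq : Rabs ((f t' - f t) / (t' - t)) < M).
  { replace ((f t' - f t) / (t' - t)) with (((f t' - f t) / (t' - t) - f' t) + f' t) by ring.
    apply Rle_lt_trans with (1 := Rabs_triang _ _). unfold M. lra. }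
  apply Rle_lt_trans with (M * Rabs (t' - t)).
  - apply Rmult_le_compat_r; [apply Rabs_pos|lra].
  - replace e with (M * (e / M)) by (field; lra). apply Rmult_lt_compat_l; lra.
Qed.

(** Freezing the argument at 0 for negative times gives functions continuous on R and, by the next
    lemma, differentiable for t > 0, so that two-sided calculus applies to them. *)
Lemma cont_nonneg_extend (f : R -> R) : cont_nonneg f -> forall t, continuous (fun t => f (Rmax 0 t)) t.
Proof.
  intros Hf t. apply continuity_pt_filterlim. intros e He.
  destruct (Hf (Rmax 0 t) (Rmax_l _ _) e He) as [d [Hd H]].
  exists d. split; [exact Hd|]. intros x [_ Hx]. simpl in *. unfold Rdist in *.
  apply H; [apply Rmax_l|]. apply Rle_lt_trans with (2 := Hx).
  unfold Rmax; destruct (Rle_dec 0 x), (Rle_dec 0 t); unfold Rabs; repeat destruct Rcase_abs; lra.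
Qed.

Lemma deriv_nonneg_extend (f f' : R -> R) t : deriv_nonneg f f' -> 0 < t ->
  is_derive (fun t => f (Rmax 0 t)) t (f' t).
Proof.
  intros Hf Ht. apply is_derive_ext_loc with f; [|apply deriv_nonneg_is_derive; assumption].
  exists (mkposreal _ Ht). intros y Hy. change (Rabs (y - t) < t) in Hy. apply Rabs_lt_between in Hy.
  rewrite Rmax_right by lra. reflexivity.
Qed.

(** The function exp(- k t) F(t) - b t has a nonpositive derivative on (0, T], and the mean value
    theorem compares its values at 0 and T. *)
Lemma gronwall (F F' : R -> R) k b T : 0 <= k -> 0 <= b -> 0 <= T ->
  (forall t, continuous F t) -> (forall t, 0 < t -> is_derive F t (F' t)) ->
  (forall t, 0 < t <= T -> F' t <= k * F t + b) -> F 0 = 0 ->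
  F T <= b * T * exp (k * T).
Proof.
  intros Hk Hb HT Hc Hd Hle H0.
  set (G := fun t => exp (- (k * t)) * F t - b * t).
  (* The mean value point may be the endpoint 0, where no derivative is assumed; the dummy value 0
     has the required sign. *)
  set (dG := fun t => if Rlt_dec 0 t then exp (- (k * t)) * (F' t - k * F t) - b else 0).
  destruct (MVT_gen G 0 T dG) as [x [Hx HG]].
  - rewrite Rmin_left, Rmax_right by lra. intros x Hx. unfold G, dG.
    destruct (Rlt_dec 0 x) as [_|]; [|lra]. auto_derive.
    + exists (F' x). apply Hd; lra.
    + replace (Derive _ x) with (F' x) by (symmetry; apply is_derive_unique, Hd; lra). ring.
  - intros x _. apply continuity_pt_filterlim. unfold G.
    apply (continuous_minus (fun t => exp (- (k * t)) * F t) (fun t => b * t)).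
    + apply (continuous_mult (fun t => exp (- (k * t))) F); [|apply Hc].
      eapply is_derive_continuous. auto_derive; [exact I|reflexivity].
    + eapply is_derive_continuous. auto_derive; [exact I|reflexivity].
  - rewrite Rmin_left, Rmax_right in Hx by lra.
    assert (Hdx : dG x <= 0).
    { unfold dG. destruct (Rlt_dec 0 x) as [Hx0|]; [|lra].
      assert (X := Hle x ltac:(lra)).
      assert (HE : 0 < exp (- (k * x)) <= 1).
      { split; [apply exp_pos|]. rewrite <- exp_0. apply exp_le_exp. nra. }
      nra. }
    assert (HGT : G T <= G 0) by nra.
    unfold G in HGT. rewrite H0 in HGT.
    replace (F T) with (exp (- (k * T)) * F T * exp (k * T)).
    2:{ rewrite exp_Ropp. field. apply Rgt_not_eq, exp_pos. }
    apply Rmult_le_compat_r; [left; apply exp_pos|]. lra.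
Qed.

(** The difference of the two solutions has zero data and solves the equation for [c'] with forcing
    (c - c') lam^2 U. Gronwall bounds its energy by X when eps is small, the damping having the
    favourable sign; a reference energy of 4 X then leaves at least X. *)
Lemma energy_stability D lam M mu c c' u v w U V W T X t0 :
  0 <= D -> 0 <= lam -> 0 <= mu -> 0 <= T -> 0 <= t0 ->
  oscillator_solution D lam c U V W -> (forall t, 0 <= t <= T -> Rabs (U t) <= M) -> 
  (forall t, t0 <= t <= T -> 4 * X <= energy lam U V t) ->
  forall eps, 0 <= eps -> eps ^ 2 * lam ^ 4 * M ^ 2 * T * exp ((lam * (1 + mu) + 1) * T) <= X ->
  unif_close c c' eps -> (forall t, 0 <= t -> 0 <= c' t <= mu) ->
  oscillator_solution D lam c' u v w -> u 0 = U 0 -> v 0 = V 0 ->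
  forall t, t0 <= t <= T -> X <= energy lam u v t.
Proof.
  intros HD Hlam Hmu HT Ht0 (dU & dV & _ & eqU) HM HX eps Heps Hsmall Hclose Hc' (du & dv & _ & equ) Hu0 Hv0 t Ht.
  set (d := fun t => u (Rmax 0 t) - U (Rmax 0 t)). set (e := fun t => v (Rmax 0 t) - V (Rmax 0 t)).
  assert (cd : forall t, continuous d t).
  { intros s. apply (continuous_minus (fun t => u (Rmax 0 t)) (fun t => U (Rmax 0 t)));
      eapply cont_nonneg_extend, deriv_nonneg_cont_nonneg; eassumption. }
  assert (ce : forall t, continuous e t).
  { intros s. apply (continuous_minus (fun t => v (Rmax 0 t)) (fun t => V (Rmax 0 t)));
      eapply cont_nonneg_extend, deriv_nonneg_cont_nonneg; eassumption. }
  assert (dd : forall t, 0 < t -> is_derive d t (v t - V t)).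
  { intros s Hs. apply (is_derive_minus (fun t => u (Rmax 0 t)) (fun t => U (Rmax 0 t)));
      eapply deriv_nonneg_extend; eassumption. }
  assert (de : forall t, 0 < t -> is_derive e t (w t - W t)).
  { intros s Hs. apply (is_derive_minus (fun t => v (Rmax 0 t)) (fun t => V (Rmax 0 t)));
      eapply deriv_nonneg_extend; eassumption. }
  assert (HM0 : 0 <= M).
  { apply Rle_trans with (2 := HM 0 ltac:(lra)). apply Rabs_pos. }
  set (F := fun t => e t ^ 2 + lam ^ 2 * d t ^ 2).
  set (F' := fun t => 2 * e t * (w t - W t) + lam ^ 2 * (2 * d t * (v t - V t))).
  assert (HF : F t <= eps ^ 2 * lam ^ 4 * M ^ 2 * t * exp ((lam * (1 + mu) + 1) * t)).
  { apply (gronwall F F').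
    - nra.
    - repeat apply Rmult_le_pos; try apply pow_le; lra.
    - lra.
    - intros s. apply (continuous_plus (fun t => e t ^ 2) (fun t => lam ^ 2 * d t ^ 2)).
      + apply (continuous_comp e (fun x => x ^ 2)); [apply ce|].
        eapply is_derive_continuous. auto_derive; [exact I|reflexivity].
      + apply (continuous_comp d (fun x => lam ^ 2 * x ^ 2)); [apply cd|].
        eapply is_derive_continuous. auto_derive; [exact I|reflexivity].
    - intros s Hs. unfold F, F'. auto_derive.
      + split; [eexists; apply de, Hs|split; [eexists; apply dd, Hs|exact I]].
      + replace (Derive _ s) with (w s - W s) at 1 by (symmetry; apply is_derive_unique, de, Hs).
        replace (Derive _ s) with (v s - V s) by (symmetry; apply is_derive_unique, dd, Hs).
        ring.
    - intros s Hs. unfold F, F', d, e. rewrite Rmax_right by lra.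
      specialize (eqU s ltac:(lra)). specialize (equ s ltac:(lra)).
      specialize (Hclose s ltac:(lra)). specialize (Hc' s ltac:(lra)).
      specialize (HM s ltac:(lra)).
      set (a := v s - V s). set (z := u s - U s).
      set (g := c s - c' s) in *.
      replace (w s - W s) with (- 2 * D * a - c' s * lam ^ 2 * z + g * lam ^ 2 * U s)
        by (unfold a, z, g; lra).
      (* The two cross terms combine into 2 lam^2 a z (1 - c'), and |1 - c'| <= 1 + mu. *)
      assert (A1 : 2 * lam * a * (lam * z) * (1 - c' s) <= lam * (1 + mu) * (a ^ 2 + lam ^ 2 * z ^ 2)).
      { assert (B1 : 2 * a * (lam * z) * (1 - c' s) <= (1 + mu) * (a ^ 2 + (lam * z) ^ 2)).
        { assert (0 <= (a - lam * z) ^ 2) by apply pow2_ge_0.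
          assert (0 <= (a + lam * z) ^ 2) by apply pow2_ge_0.
          nra. }
        apply Rmult_le_compat_l with (r := lam) in B1; [|exact Hlam]. nra. }
      (* Young's inequality: the forcing contributes the [+ 1] of the Gronwall exponent and the
         constant source. *)
      assert (A2 : 2 * a * (g * lam ^ 2 * U s) <= a ^ 2 + eps ^ 2 * lam ^ 4 * M ^ 2).
      { assert (0 <= (a - g * lam ^ 2 * U s) ^ 2) by apply pow2_ge_0.
        assert (g ^ 2 <= eps ^ 2) by (apply pow_maj_Rabs; exact Hclose).
        assert (U s ^ 2 <= M ^ 2) by (apply pow_maj_Rabs; exact HM).
        assert (0 <= lam ^ 4) by (apply pow_le; lra).
        assert (g ^ 2 * (U s) ^ 2 <= eps ^ 2 * M ^ 2)
          by (apply Rmult_le_compat; try apply pow2_ge_0; assumption).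
        assert (lam ^ 4 * (g ^ 2 * (U s) ^ 2) <= lam ^ 4 * (eps ^ 2 * M ^ 2))
          by (apply Rmult_le_compat_l; assumption).
        nra. }
      assert (A3 : 0 <= D * a ^ 2) by (apply Rmult_le_pos; [exact HD|apply pow2_ge_0]).
      assert (0 <= lam ^ 2 * z ^ 2) by (apply Rmult_le_pos; apply pow2_ge_0).
      nra.
    - unfold F, d, e. rewrite Rmax_left by lra. rewrite Hu0, Hv0. ring. }
  assert (HFX : F t <= X).
  { apply Rle_trans with (1 := HF). apply Rle_trans with (2 := Hsmall).
    apply Rmult_le_compat.
    - repeat apply Rmult_le_pos; try apply pow_le; lra.
    - left; apply exp_pos.
    - apply Rmult_le_compat_l; [|lra]. repeat apply Rmult_le_pos; try apply pow_le; lra.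
    - apply exp_le_exp, Rmult_le_compat_l; [nra|lra]. }
  specialize (HX t Ht). unfold energy in *. unfold F, d, e in HFX. rewrite Rmax_right in HFX by lra.
  (* This square gives V^2 <= 2 v^2 + 2 (v - V)^2; the next one does the same for the positions. *)
  assert (0 <= (2 * v t - V t) ^ 2) by apply pow2_ge_0.
  assert (0 <= lam ^ 2 * (2 * u t - U t) ^ 2) by (apply Rmult_le_pos; apply pow2_ge_0).
  nra.
Qed.

(** * An explicit resonant solution *)

Section Explicit_solution.
Variables (m m1 m2 : R -> R) (mu1 mu2 K : R).
Hypothesis mu1_pos : 0 < mu1.
Hypothesis m_derive : forall t, is_derive m t (m1 t).
Hypothesis m1_derive : forall t, is_derive m1 t (m2 t).
Hypothesis m1_bound : forall t, Rabs (m1 t) <= K.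
Hypothesis m_bounds : forall t, mu1 <= m t <= mu2.

Definition gam (t : R) : R := sqrt (m t).
Definition phase (lam t : R) : R := lam * RInt gam 0 t.
Definition sn (lam t : R) : R := sin (phase lam t).
Definition cs (lam t : R) : R := cos (phase lam t).
Definition sn2_int (lam t : R) : R := RInt (fun s => sn lam s ^ 2) 0 t.
(** The derivative of ln m / 4, that is, minus the logarithmic derivative of the WKB amplitude
    m^(-1/4). *)
Definition logder (t : R) : R := m1 t / (4 * m t).
Definition logder' (t : R) : R := (m2 t * m t - m1 t ^ 2) / (4 * m t ^ 2).
Definition amp (D B lam t : R) : R := exp (- ln (m t) / 4 - D * t + B * sn2_int lam t).
Definition rate (D B lam t : R) : R := B * sn lam t ^ 2 - logder t - D.
(** Normalizes the initial velocity of [sol] to 1, the data prescribed in [activated]. *)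
Definition norm0 (D B lam : R) : R := / (amp D B lam 0 * (lam * gam 0)).
(* The speed for which [amp * sn] solves the equation with damping [2 D]: its leading perturbation
   [- 2 (B / lam) gam sin (2 phase)] resonates with the solution. *)
Definition speed (D B lam t : R) : R :=
  m t - 4 * (B / lam) * gam t * sn lam t * cs lam t
  + (D ^ 2 - (B * sn lam t ^ 2 - logder t) ^ 2 + logder' t) / lam ^ 2.
Definition sol (D B lam t : R) : R := norm0 D B lam * (amp D B lam t * sn lam t).
Definition sol' (D B lam t : R) : R :=
  norm0 D B lam * (amp D B lam t * (rate D B lam t * sn lam t + lam * gam t * cs lam t)).
(** Read off from the equation, which then holds by definition; the content is that this is the
    derivative of [sol']. *)
Definition sol'' (D B lam t : R) : R :=
  - (2 * D * sol' D B lam t) - speed D B lam t * lam ^ 2 * sol D B lam t.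

Lemma m_pos t : 0 < m t.
Proof. destruct (m_bounds t); lra. Qed.

Lemma gam_pos t : 0 < gam t.
Proof. apply sqrt_lt_R0, m_pos. Qed.

Lemma gam_sqr t : gam t * gam t = m t.
Proof. apply sqrt_sqrt, Rlt_le, m_pos. Qed.

Lemma is_derive_gam t : is_derive gam t (m1 t / (2 * gam t)).
Proof.
  assert (Hm := m_pos t). unfold gam. auto_derive.
  - split; [eexists; apply m_derive|split; [exact Hm|exact I]].
  - rewrite (is_derive_unique (fun x : R => m x) _ _ (m_derive t)).
    field. apply Rgt_not_eq, gam_pos.
Qed.

Lemma gam_continuous t : continuous gam t.
Proof. exact (is_derive_continuous _ _ _ (is_derive_gam t)). Qed.

Lemma is_derive_phase lam t : is_derive (phase lam) t (lam * gam t).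
Proof. apply is_derive_scal, is_derive_primitive, gam_continuous. Qed.

Lemma is_derive_sn lam t : is_derive (sn lam) t (lam * gam t * cs lam t).
Proof.
  unfold sn, cs. auto_derive; [eexists; apply is_derive_phase|].
  rewrite (is_derive_unique (fun x : R => phase lam x) _ _ (is_derive_phase lam t)). ring.
Qed.

Lemma is_derive_cs lam t : is_derive (cs lam) t (- (lam * gam t * sn lam t)).
Proof.
  unfold sn, cs. auto_derive; [eexists; apply is_derive_phase|].
  rewrite (is_derive_unique (fun x : R => phase lam x) _ _ (is_derive_phase lam t)). ring.
Qed.

Lemma sn2_cs2 lam t : sn lam t ^ 2 + cs lam t ^ 2 = 1.
Proof. unfold sn, cs. rewrite <- (sin2_cos2 (phase lam t)). unfold Rsqr. ring. Qed.

Lemma sn_bound lam t : Rabs (sn lam t) <= 1.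
Proof. apply Rabs_le_between, SIN_bound. Qed.

Lemma cs_bound lam t : Rabs (cs lam t) <= 1.
Proof. apply Rabs_le_between, COS_bound. Qed.

Lemma is_derive_sn2_int lam t : is_derive (sn2_int lam) t (sn lam t ^ 2).
Proof.
  apply (is_derive_primitive (fun s => sn lam s ^ 2)). intros s.
  apply (continuous_comp (sn lam) (fun x => x ^ 2)).
  - exact (is_derive_continuous _ _ _ (is_derive_sn lam s)).
  - eapply is_derive_continuous. auto_derive; [exact I|reflexivity].
Qed.

Lemma is_derive_logder t : is_derive logder t (logder' t).
Proof.
  assert (Hm := m_pos t). unfold logder, logder'. auto_derive.
  - split; [eexists; apply m1_derive|split; [eexists; apply m_derive|split; [lra|exact I]]].
  - rewrite (is_derive_unique (fun x : R => m x) _ _ (m_derive t)).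
    rewrite (is_derive_unique (fun x : R => m1 x) _ _ (m1_derive t)). field. lra.
Qed.

Lemma is_derive_amp D B lam t : is_derive (amp D B lam) t (amp D B lam t * rate D B lam t).
Proof.
  assert (Hm := m_pos t). unfold amp. auto_derive.
  - split; [eexists; apply m_derive|split; [exact Hm|split; [eexists; apply is_derive_sn2_int|exact I]]].
  - rewrite (is_derive_unique (fun x : R => m x) _ _ (m_derive t)).
    rewrite (is_derive_unique (fun x : R => sn2_int lam x) _ _ (is_derive_sn2_int lam t)).
    unfold rate, logder, Rminus, Rdiv. field. lra.
Qed.

Lemma is_derive_rate D B lam t :
  is_derive (rate D B lam) t (2 * B * sn lam t * (lam * gam t * cs lam t) - logder' t).
Proof.
  unfold rate. auto_derive.
  - split; [eexists; apply is_derive_sn|split; [eexists; apply is_derive_logder|exact I]].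
  - rewrite (is_derive_unique (fun x : R => sn lam x) _ _ (is_derive_sn lam t)).
    rewrite (is_derive_unique (fun x : R => logder x) _ _ (is_derive_logder t)). ring.
Qed.

Lemma is_derive_sol D B lam t : is_derive (sol D B lam) t (sol' D B lam t).
Proof.
  unfold sol, sol'. auto_derive.
  - split; [eexists; apply is_derive_amp|split; [eexists; apply is_derive_sn|exact I]].
  - rewrite (is_derive_unique (fun x : R => sn lam x) _ _ (is_derive_sn lam t)).
    rewrite (is_derive_unique (fun x : R => amp D B lam x) _ _ (is_derive_amp D B lam t)). ring.
Qed.

(* The choice of [speed] cancels the coefficient of the sine, and the [- m'/(4 m)] in [rate] leaves
   in the coefficient of the cosine only a multiple of [sn ^ 2]. *)
Lemma is_derive_sol' D B lam t : lam <> 0 -> is_derive (sol' D B lam) t (sol'' D B lam t).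
Proof.
  intros Hlam. assert (Hm := m_pos t). assert (Hg := gam_pos t).
  unfold sol'. auto_derive.
  - assert (X1 := is_derive_amp D B lam t). assert (X2 := is_derive_rate D B lam t).
    assert (X3 := is_derive_sn lam t). assert (X4 := is_derive_gam t). assert (X5 := is_derive_cs lam t).
    intuition (eexists; eassumption).
  - rewrite (is_derive_unique (fun x : R => sn lam x) _ _ (is_derive_sn lam t)).
    rewrite (is_derive_unique (fun x : R => cs lam x) _ _ (is_derive_cs lam t)).
    rewrite (is_derive_unique (fun x : R => gam x) _ _ (is_derive_gam t)).
    rewrite (is_derive_unique (fun x : R => rate D B lam x) _ _ (is_derive_rate D B lam t)).
    rewrite (is_derive_unique (fun x : R => amp D B lam x) _ _ (is_derive_amp D B lam t)).
    unfold sol'', speed, sol', sol, rate.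
    assert (Hl : logder t = m1 t / (4 * (gam t * gam t))) by (unfold logder; rewrite gam_sqr; reflexivity).
    rewrite <- (gam_sqr t), Hl. field. split; lra.
Qed.

Lemma sol_0 D B lam : sol D B lam 0 = 0.
Proof.
  unfold sol, sn, phase. rewrite RInt_point. unfold zero; simpl. rewrite Rmult_0_r, sin_0. ring.
Qed.

Lemma sol'_0 D B lam : lam <> 0 -> sol' D B lam 0 = 1.
Proof.
  intros Hlam. unfold sol', norm0, sn, cs, phase. rewrite RInt_point. unfold zero; simpl.
  rewrite Rmult_0_r, sin_0, cos_0. assert (Hg := gam_pos 0). field. repeat split; try lra.
  apply Rgt_not_eq, exp_pos.
Qed.

Lemma sol_oscillator D B lam : lam <> 0 -> (forall t, continuous (speed D B lam) t) ->
  oscillator_solution D lam (speed D B lam) (sol D B lam) (sol' D B lam) (sol'' D B lam).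
Proof.
  intros Hlam Hc. split; [|split; [|split]].
  - apply is_derive_deriv_nonneg. intros; apply is_derive_sol.
  - apply is_derive_deriv_nonneg. intros; apply is_derive_sol', Hlam.
  - apply continuous_cont_nonneg. intros t _. unfold sol''.
    apply (continuous_minus (fun t => - (2 * D * sol' D B lam t))).
    + apply (continuous_comp (sol' D B lam) (fun x => - (2 * D * x))).
      * exact (is_derive_continuous _ _ _ (is_derive_sol' _ _ _ _ Hlam)).
      * eapply is_derive_continuous. auto_derive; [exact I|reflexivity].
    + apply (continuous_mult (fun t => speed D B lam t * lam ^ 2) (sol D B lam)).
      * apply (continuous_mult (speed D B lam) (fun _ => lam ^ 2)); [apply Hc|apply continuous_const].
      * exact (is_derive_continuous _ _ _ (is_derive_sol _ _ _ _)).
  - intros t _. unfold sol''. ring.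
Qed.

(** sin^2 is 1/2 - cos(2 phase) / 2, and integrating the oscillating part by parts gives O((1 + t) /
    lam). [K1] controls the term from the derivative of 1 / gam, [K2] the boundary term. *)
Lemma sn2_int_lower : exists KJ, 0 <= KJ /\
  forall lam t, 0 < lam -> 0 <= t -> t / 2 - KJ * (1 + t) / lam <= sn2_int lam t.
Proof.
  set (g0 := sqrt mu1). assert (Hg0 : 0 < g0) by (apply sqrt_lt_R0, mu1_pos).
  assert (Hg : forall t, g0 <= gam t) by (intros t; apply sqrt_le_1_alt, m_bounds).
  assert (HK : 0 <= K) by (apply Rle_trans with (2 := m1_bound 0); apply Rabs_pos).
  set (K1 := K / (4 * g0 ^ 3)). set (K2 := / (2 * g0)).
  assert (HK1 : 0 <= K1).
  { apply Rmult_le_pos; [exact HK|]. left. apply Rinv_0_lt_compat, Rmult_lt_0_compat; [lra|]. apply pow_lt, Hg0. }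
  assert (HK2 : 0 <= K2) by (left; apply Rinv_0_lt_compat; lra).
  exists (K1 + K2). split; [lra|]. intros lam t Hlam Ht.
  (* The derivative of sn cs / (2 lam gam) is (cs^2 - sn^2) / 2 up to O(1 / lam). It cancels sn^2 -
     1/2, and the last summand makes [h] nondecreasing. *)
  set (h := fun t => sn2_int lam t - t / 2 + sn lam t * cs lam t / (2 * lam * gam t) + K1 / lam * t).
  set (h' := fun t => - (sn lam t * cs lam t * m1 t / (4 * lam * gam t ^ 3)) + K1 / lam).
  assert (Hh : forall t, is_derive h t (h' t)).
  { intros s. assert (X := gam_pos s). unfold h, h'. auto_derive.
    - assert (X1 := is_derive_sn2_int lam s). assert (X3 := is_derive_sn lam s).
      assert (X4 := is_derive_gam s). assert (X5 := is_derive_cs lam s).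
      assert (2 * lam * gam s <> 0) by (apply Rmult_integral_contrapositive; split; lra).
      intuition (eexists; eassumption).
    - rewrite (is_derive_unique (fun x : R => sn lam x) _ _ (is_derive_sn lam s)).
      rewrite (is_derive_unique (fun x : R => cs lam x) _ _ (is_derive_cs lam s)).
      rewrite (is_derive_unique (fun x : R => gam x) _ _ (is_derive_gam s)).
      rewrite (is_derive_unique (fun x : R => sn2_int lam x) _ _ (is_derive_sn2_int lam s)).
      assert (E := sn2_cs2 lam s).
      replace (sn lam s ^ 2) with (1 / 2 * (sn lam s ^ 2 + 1 - cs lam s ^ 2)) by lra.
      field. split; lra. }
  assert (Hsc : forall s, Rabs (sn lam s * cs lam s) <= 1).
  { intros s. rewrite Rabs_mult, <- (Rmult_1_r 1).
    apply Rmult_le_compat; try apply Rabs_pos; [apply sn_bound|apply cs_bound]. }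
  assert (Hh' : forall s, 0 <= h' s).
  { intros s. assert (X := gam_pos s). unfold h'.
    assert (Y : Rabs (sn lam s * cs lam s * m1 s / (4 * lam * gam s ^ 3)) <= K1 / lam).
    { unfold Rdiv. rewrite Rabs_mult, Rabs_mult, (Rabs_pos_eq (/ _)).
      2:{ left. apply Rinv_0_lt_compat. apply Rmult_lt_0_compat; [lra|apply pow_lt, X]. }
      apply Rle_trans with (1 * K * / (4 * lam * g0 ^ 3)).
      - apply Rmult_le_compat.
        + apply Rmult_le_pos; apply Rabs_pos.
        + left. apply Rinv_0_lt_compat. apply Rmult_lt_0_compat; [lra|apply pow_lt, X].
        + apply Rmult_le_compat; try apply Rabs_pos; auto.
        + apply Rinv_le_contravar.
          * apply Rmult_lt_0_compat; [lra|apply pow_lt, Hg0].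
          * apply Rmult_le_compat_l; [lra|]. apply pow_incr. split; [lra|apply Hg].
      - right. unfold K1. field. split; lra. }
    apply Rabs_le_between in Y. lra. }
  assert (Hht : h 0 <= h t).
  { destruct (MVT_gen h 0 t h') as [x [_ Hx]].
    - intros; apply Hh.
    - intros. apply continuity_pt_filterlim. exact (is_derive_continuous _ _ _ (Hh x)).
    - assert (Y := Hh' x). nra. }
  assert (Hh0 : h 0 = 0).
  { unfold h, sn2_int, sn, phase. rewrite !RInt_point. unfold zero; simpl.
    rewrite Rmult_0_r, sin_0. unfold Rdiv. ring. }
  assert (Hq : sn lam t * cs lam t / (2 * lam * gam t) <= K2 / lam).
  { assert (X := gam_pos t). apply Rle_trans with (1 / (2 * lam * gam t)).
    - apply Rmult_le_compat_r; [left; apply Rinv_0_lt_compat; repeat apply Rmult_lt_0_compat; lra|].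
      apply Rle_trans with (1 := Rle_abs _). apply Hsc.
    - replace (K2 / lam) with (1 / (2 * lam * g0)) by (unfold K2; field; lra).
      apply Rmult_le_compat_l; [lra|]. apply Rinv_le_contravar; [repeat apply Rmult_lt_0_compat; lra|].
      apply Rmult_le_compat_l; [lra|apply Hg]. }
  rewrite Hh0 in Hht. unfold h in Hht.
  assert (0 <= K2 / lam * t /\ 0 <= K1 / lam).
  { split; [apply Rmult_le_pos; [|exact Ht]|]; apply Rmult_le_pos; try lra;
      left; apply Rinv_0_lt_compat, Hlam. }
  replace ((K1 + K2) * (1 + t) / lam) with (K1 / lam * t + K1 / lam + K2 / lam + K2 / lam * t)
    by (unfold Rdiv; ring). lra.
Qed.

(** The energy is the squared amplitude ratio times a factor that cannot degenerate: where the sine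
    vanishes the cosine carries the velocity, and [rate] is too small against lam to cancel it. The
    logarithms come from m^(-1/4). *)
Lemma sol_energy_lower D B lam t KJ : 0 < lam -> 0 <= B -> 0 <= t -> 
  (t / 2 - KJ * (1 + t) / lam <= sn2_int lam t) -> rate D B lam t ^ 2 <= lam ^ 2 / 2 ->
  Rmin mu1 1 / (2 * mu2) *
    exp (2 * ((B / 2 - D) * t - B * KJ * (1 + t) / lam - (ln mu2 - ln mu1) / 4))
  <= energy lam (sol D B lam) (sol' D B lam) t.
Proof.
  intros Hlam HB Ht HJ Hr.
  assert (Ha0 : 0 < amp D B lam 0) by apply exp_pos.
  assert (Hg0 := gam_pos 0). assert (Hmt := m_bounds t). assert (Hm0 := m_bounds 0).
  set (X := (B / 2 - D) * t - B * KJ * (1 + t) / lam - (ln mu2 - ln mu1) / 4).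
  assert (Hratio : exp X <= amp D B lam t / amp D B lam 0).
  { unfold amp.
    assert (Hdiv : forall a b, exp a / exp b = exp (a - b))
      by (intros; unfold Rminus; rewrite exp_plus, exp_Ropp; reflexivity).
    rewrite Hdiv. apply exp_le_exp.
    assert (E0 : sn2_int lam 0 = 0) by (unfold sn2_int; rewrite RInt_point; reflexivity).
    rewrite E0.
    assert (L1 : ln (m t) <= ln mu2) by (apply ln_le; lra).
    assert (L2 : ln mu1 <= ln (m 0)) by (apply ln_le; lra).
    apply Rmult_le_compat_l with (r := B) in HJ; [|exact HB].
    unfold X. replace (B * KJ * (1 + t) / lam) with (B * (KJ * (1 + t) / lam)) by (unfold Rdiv; ring).
    lra. }
  set (Z := (rate D B lam t * sn lam t + lam * gam t * cs lam t) ^ 2 + lam ^ 2 * sn lam t ^ 2).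
  assert (HZ : lam ^ 2 * (Rmin mu1 1 / 2) <= Z).
  { unfold Z. set (r := rate D B lam t) in *. set (s := sn lam t). set (c := cs lam t).
    assert (E : s ^ 2 + c ^ 2 = 1) by apply sn2_cs2.
    (* Gives (x + y)^2 >= y^2 / 2 - x^2 for x = r s and y = lam gam c; the loss r^2 s^2 is at most
       half of the position term lam^2 s^2. *)
    assert (Q1 : 0 <= (2 * r * s + lam * gam t * c) ^ 2) by apply pow2_ge_0.
    assert (Q2 : r ^ 2 * s ^ 2 <= lam ^ 2 / 2 * s ^ 2) by (apply Rmult_le_compat_r; [apply pow2_ge_0|exact Hr]).
    assert (Q3 : lam ^ 2 * mu1 * c ^ 2 <= (lam * gam t * c) ^ 2).
    { replace ((lam * gam t * c) ^ 2) with (lam ^ 2 * (gam t * gam t) * c ^ 2) by ring.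
      rewrite gam_sqr. apply Rmult_le_compat_r; [apply pow2_ge_0|].
      apply Rmult_le_compat_l; [apply pow2_ge_0|lra]. }
    assert (Q4 : lam ^ 2 * c ^ 2 * Rmin mu1 1 <= lam ^ 2 * c ^ 2 * mu1).
    { apply Rmult_le_compat_l; [apply Rmult_le_pos; apply pow2_ge_0|apply Rmin_l]. }
    assert (Q5 : lam ^ 2 * s ^ 2 * Rmin mu1 1 <= lam ^ 2 * s ^ 2 * 1).
    { apply Rmult_le_compat_l; [apply Rmult_le_pos; apply pow2_ge_0|apply Rmin_r]. }
    replace (lam ^ 2 * (Rmin mu1 1 / 2)) with (lam ^ 2 * (Rmin mu1 1 / 2) * (s ^ 2 + c ^ 2))
      by (rewrite E; ring).
    nra. }
  assert (HE : energy lam (sol D B lam) (sol' D B lam) t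
     = (amp D B lam t / amp D B lam 0) ^ 2 * / (lam ^ 2 * m 0) * Z).
  { unfold energy, sol, sol', norm0, Z. rewrite <- (gam_sqr 0). field. repeat split; lra. }
  rewrite HE.
  assert (Hmin : 0 < Rmin mu1 1) by (apply Rmin_pos; lra).
  assert (Hl2 : 0 < lam ^ 2) by (apply pow_lt, Hlam).
  apply Rle_trans with (exp X ^ 2 * / (lam ^ 2 * mu2) * (lam ^ 2 * (Rmin mu1 1 / 2))).
  - right. replace (exp (2 * X)) with (exp X ^ 2). field. split; lra.
    simpl. rewrite Rmult_1_r, <- exp_plus. f_equal. ring.
  - apply Rmult_le_compat; [|apply Rmult_le_pos; lra| |exact HZ].
    + apply Rmult_le_pos; [apply pow2_ge_0|]. left. apply Rinv_0_lt_compat, Rmult_lt_0_compat; lra.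
    + apply Rmult_le_compat; [apply pow2_ge_0| | |].
      * left. apply Rinv_0_lt_compat, Rmult_lt_0_compat; lra.
      * apply pow_incr. split; [left; apply exp_pos|exact Hratio].
      * apply Rinv_le_contravar; [apply Rmult_lt_0_compat; lra|]. apply Rmult_le_compat_l; lra.
Qed.
End Explicit_solution.

(** * Asymptotics for large frequencies *)

Definition for_large (P : R -> Prop) : Prop := exists M, forall lam, M < lam -> P lam.

Lemma for_large_and P Q : for_large P -> for_large Q -> for_large (fun lam => P lam /\ Q lam).
Proof.
  intros [M HM] [N HN]. exists (Rmax M N). intros lam H.
  assert (M <= Rmax M N) by apply Rmax_l. assert (N <= Rmax M N) by apply Rmax_r.
  split; [apply HM|apply HN]; lra.
Qed.

Lemma for_large_impl (P Q : R -> Prop) : (forall lam, P lam -> Q lam) -> for_large P -> for_large Q.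
Proof. intros H [M HM]. exists M. auto. Qed.

Lemma for_large_gt a : for_large (fun lam => a < lam).
Proof. exists a. auto. Qed.

Lemma for_large_Rpower_small a e : 0 < a -> 0 < e -> for_large (fun lam => Rpower lam (- a) <= e).
Proof.
  intros Ha He. exists (Rpower e (- / a)). intros lam Hlam.
  assert (H0 : 0 < Rpower e (- / a)) by apply exp_pos.
  rewrite Rpower_Ropp. replace e with (/ Rpower (Rpower e (- / a)) a).
  - apply Rinv_le_contravar; [apply exp_pos|]. apply Rle_Rpower_l; lra.
  - rewrite Rpower_mult. replace (- / a * a) with (Ropp 1) by (field; lra).
    rewrite Rpower_Ropp, Rpower_1, Rinv_inv by lra. reflexivity.
Qed.

Lemma for_large_Rpower_large a M : 0 < a -> for_large (fun lam => M <= Rpower lam a).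
Proof.
  intros Ha. assert (HM : 0 < Rmax M 1) by (apply Rlt_le_trans with 1; [lra|apply Rmax_r]).
  apply for_large_impl with (2 := for_large_Rpower_small a (/ Rmax M 1) Ha (Rinv_0_lt_compat _ HM)).
  intros lam H. rewrite Rpower_Ropp in H.
  apply Rle_trans with (Rmax M 1); [apply Rmax_l|].
  rewrite <- (Rinv_inv (Rmax M 1)), <- (Rinv_inv (Rpower lam a)).
  apply Rinv_le_contravar; [|exact H]. apply Rinv_0_lt_compat, exp_pos.
Qed.

Lemma for_large_inv_ln e : 0 < e -> for_large (fun lam => / ln (2 + lam) <= e).
Proof.
  intros He. exists (exp (/ e)). intros lam H.
  rewrite <- (Rinv_inv e). apply Rinv_le_contravar; [apply Rinv_0_lt_compat, He|].
  rewrite <- (ln_exp (/ e)). apply ln_le; [apply exp_pos|lra].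
Qed.

(** * Calculus of bounded Lipschitz functions depending on the frequency *)

Definition bounded_lipschitz (A L : R) (f : R -> R) : Prop :=
  (forall t, Rabs (f t) <= A) /\ (forall t s, Rabs (f t - f s) <= L * Rabs (t - s)).

Lemma bounded_lipschitz_mult A1 L1 A2 L2 f g :
  bounded_lipschitz A1 L1 f -> bounded_lipschitz A2 L2 g ->
  bounded_lipschitz (A1 * A2) (A1 * L2 + L1 * A2) (fun t => f t * g t).
Proof.
  intros [Hf Hf'] [Hg Hg']. split.
  - intros t. rewrite Rabs_mult. apply Rmult_le_compat; try apply Rabs_pos; auto.
  - intros t s. replace (f t * g t - f s * g s) with (f t * (g t - g s) + (f t - f s) * g s) by ring.
    apply Rle_trans with (1 := Rabs_triang _ _). rewrite !Rabs_mult.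
    replace ((A1 * L2 + L1 * A2) * Rabs (t - s))
      with (A1 * (L2 * Rabs (t - s)) + L1 * Rabs (t - s) * A2) by ring.
    apply Rplus_le_compat; apply Rmult_le_compat; try apply Rabs_pos; auto.
Qed.

Lemma bounded_lipschitz_plus A1 L1 A2 L2 f g :
  bounded_lipschitz A1 L1 f -> bounded_lipschitz A2 L2 g ->
  bounded_lipschitz (A1 + A2) (L1 + L2) (fun t => f t + g t).
Proof.
  intros [Hf Hf'] [Hg Hg']. split.
  - intros t. apply Rle_trans with (1 := Rabs_triang _ _). apply Rplus_le_compat; auto.
  - intros t s. replace (f t + g t - (f s + g s)) with ((f t - f s) + (g t - g s)) by ring.
    apply Rle_trans with (1 := Rabs_triang _ _). rewrite Rmult_plus_distr_r.
    apply Rplus_le_compat; auto.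
Qed.

Lemma bounded_lipschitz_const a : bounded_lipschitz (Rabs a) 0 (fun _ => a).
Proof. split; [intros; lra|]. intros. rewrite Rminus_diag, Rabs_R0. lra. Qed.

Lemma bounded_lipschitz_weaken A L A' L' f :
  A <= A' -> L <= L' -> bounded_lipschitz A L f -> bounded_lipschitz A' L' f.
Proof.
  intros HA HL [Hf Hf']. split.
  - intros t. apply Rle_trans with A; auto.
  - intros t s. apply Rle_trans with (1 := Hf' t s). apply Rmult_le_compat_r; [apply Rabs_pos|exact HL].
Qed.

Lemma bounded_lipschitz_derive A L (f f' : R -> R) :
  (forall t, is_derive f t (f' t)) -> (forall t, Rabs (f t) <= A) -> (forall t, Rabs (f' t) <= L) ->
  bounded_lipschitz A L f.
Proof. intros Hd HA HL. split; [exact HA|]. exact (lipschitz_of_derive f f' L Hd HL). Qed.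

(** Size O(1) and slope O(lam), as for polynomials in the sine and cosine of the phase. Stability
    under sums and products spares explicit constants for the lower order terms. *)
Definition oscillating (f : R -> R -> R) : Prop :=
  exists C, 0 <= C /\ forall lam, 1 <= lam -> bounded_lipschitz C (C * lam) (f lam).

Lemma oscillating_const (a : R -> R) A : (forall lam, 1 <= lam -> Rabs (a lam) <= A) ->
  oscillating (fun lam _ => a lam).
Proof.
  intros Ha. assert (HA : 0 <= A) by (apply Rle_trans with (2 := Ha 1 ltac:(lra)); apply Rabs_pos).
  exists A. split; [exact HA|]. intros lam Hlam.
  apply bounded_lipschitz_weaken with (3 := bounded_lipschitz_const (a lam)); [auto|nra].
Qed.

Lemma oscillating_fixed A L f : bounded_lipschitz A L f -> oscillating (fun _ => f).
Proof.
  intros Hf. exists (Rmax 0 (Rmax A L)). split; [apply Rmax_l|]. intros lam Hlam.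
  assert (Rmax A L <= Rmax 0 (Rmax A L)) by apply Rmax_r.
  assert (0 <= Rmax 0 (Rmax A L)) by apply Rmax_l.
  assert (A <= Rmax A L) by apply Rmax_l. assert (L <= Rmax A L) by apply Rmax_r.
  apply bounded_lipschitz_weaken with (3 := Hf); [lra|nra].
Qed.

Lemma oscillating_mult f g : oscillating f -> oscillating g ->
  oscillating (fun lam t => f lam t * g lam t).
Proof.
  intros (C1 & H1 & Hf) (C2 & H2 & Hg). exists (2 * (C1 * C2)).
  assert (0 <= C1 * C2) by (apply Rmult_le_pos; assumption).
  split; [lra|]. intros lam Hlam.
  apply bounded_lipschitz_weaken with (3 := bounded_lipschitz_mult _ _ _ _ _ _ (Hf lam Hlam) (Hg lam Hlam));
    [lra|right; ring].
Qed.

Lemma oscillating_scal f (a : R -> R) A : (forall lam, 1 <= lam -> Rabs (a lam) <= A) ->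
  oscillating f -> oscillating (fun lam t => a lam * f lam t).
Proof. intros Ha Hf. apply oscillating_mult; [apply oscillating_const with A, Ha|exact Hf]. Qed.

Lemma oscillating_plus f g : oscillating f -> oscillating g ->
  oscillating (fun lam t => f lam t + g lam t).
Proof.
  intros (C1 & H1 & Hf) (C2 & H2 & Hg). exists (C1 + C2). split; [lra|]. intros lam Hlam.
  apply bounded_lipschitz_weaken with (3 := bounded_lipschitz_plus _ _ _ _ _ _ (Hf lam Hlam) (Hg lam Hlam));
    [lra|right; ring].
Qed.

Lemma oscillating_ext f g : (forall lam t, f lam t = g lam t) -> oscillating f -> oscillating g.
Proof.
  intros E (C & HC & Hf). exists C. split; [exact HC|]. intros lam Hlam. destruct (Hf lam Hlam) as [H1 H2].
  split; intros; rewrite <- !E; auto.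
Qed.

(** The Hoelder constants of m and p cannot simply be added, as H - theta + 3H/4 may exceed H. At
    distances up to [eta] the Lipschitz bound makes m use only H/4, leaving 3H/4 to p; beyond [eta],
    m uses H - theta and the total oscillation of p, of order lam^(-alpha), fits into theta. *)
Lemma PS_perturbation mu1 mu2 alpha H theta L P1 P2 P3 m (p : R -> R -> R) eps :
  0 < alpha < 1 -> 0 < H -> 0 < theta -> 0 <= L -> 0 < P1 -> 0 < P2 -> 0 < P3 -> 0 < eps ->
  Rpower P1 (1 - alpha) * Rpower P2 alpha <= 3 * H / 4 ->
  (forall t, mu1 + theta <= m t <= mu2 - theta) ->
  (forall t s, Rabs (m t - m s) <= (H - theta) * powR (Rabs (t - s)) alpha) ->
  (forall t s, Rabs (m t - m s) <= L * Rabs (t - s)) ->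
  for_large (fun lam =>
    (forall t, Rabs (p lam t) <= P3 * Rpower lam (- alpha)) /\
    (forall t s, Rabs (p lam t - p lam s) <= P1 * Rpower lam (- alpha)) /\
    (forall t s, Rabs (p lam t - p lam s) <= P2 * Rpower lam (1 - alpha) * Rabs (t - s))) ->
  for_large (fun lam => PS mu1 mu2 alpha H (fun t => m t + p lam t) /\ forall t, Rabs (p lam t) <= eps).
Proof.
  intros Ha HH Hth HL HP1 HP2 HP3 Heps HP Hb Hh Hlip Hp.
  (* For d <= eta this yields L d = L d^(1-alpha) d^alpha <= (H/4) d^alpha; [L + 1] keeps the
     denominator positive when L = 0. *)
  destruct (powR_small (1 - alpha) (H / (4 * (L + 1)))) as [eta [Heta Hsmall]];
    [lra|apply Rdiv_lt_0_compat; lra|].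
  assert (Hpe : 0 < powR eta alpha) by (rewrite powR_pos_eq by exact Heta; apply exp_pos).
  assert (T1 : 0 < theta * powR eta alpha / P1) by (apply Rdiv_lt_0_compat; [apply Rmult_lt_0_compat|]; lra).
  assert (T2 : 0 < Rmin theta eps / P3) by (apply Rdiv_lt_0_compat; [apply Rmin_pos; lra|lra]).
  apply for_large_impl with (2 := for_large_and _ _ Hp (for_large_and _ _ (for_large_gt 0)
    (for_large_and _ _ (for_large_Rpower_small alpha _ (proj1 Ha) T1)
       (for_large_Rpower_small alpha _ (proj1 Ha) T2)))).
  intros lam ((B3 & B1 & B2) & Hlam & S1 & S2).
  assert (Hx : 0 < Rpower lam (- alpha)) by apply exp_pos.
  assert (S1' : P1 * Rpower lam (- alpha) <= theta * powR eta alpha).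
  { apply Rle_trans with (P1 * (theta * powR eta alpha / P1)); [apply Rmult_le_compat_l; lra|right; field; lra]. }
  assert (S2' : P3 * Rpower lam (- alpha) <= Rmin theta eps).
  { apply Rle_trans with (P3 * (Rmin theta eps / P3)); [apply Rmult_le_compat_l; lra|right; field; lra]. }
  assert (Rmin theta eps <= theta) by apply Rmin_l. assert (Rmin theta eps <= eps) by apply Rmin_r.
  split; [split|].
  - intros t _. specialize (B3 t). apply Rabs_le_between in B3. specialize (Hb t). lra.
  - intros t s _ _. set (d := Rabs (t - s)).
    assert (Hd : 0 <= d) by apply Rabs_pos. assert (Hpd : 0 <= powR d alpha) by apply powR_nonneg.
    replace (m t + p lam t - (m s + p lam s)) with ((m t - m s) + (p lam t - p lam s)) by ring.
    apply Rle_trans with (1 := Rabs_triang _ _).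
    destruct (Rle_or_lt d eta) as [Hde|Hde].
    + assert (X1 : Rabs (m t - m s) <= H / 4 * powR d alpha).
      { apply Rle_trans with (1 := Hlip t s). fold d.
        destruct (Req_dec d 0) as [E|Hd0]; [rewrite E in *; nra|].
        replace d with (powR d (1 - alpha) * powR d alpha) at 1.
        2:{ rewrite !powR_pos_eq by lra. rewrite <- Rpower_plus.
            replace (1 - alpha + alpha) with 1 by ring. apply Rpower_1; lra. }
        rewrite <- Rmult_assoc. apply Rmult_le_compat_r; [exact Hpd|].
        apply Rle_trans with (L * (H / (4 * (L + 1)))).
        - apply Rmult_le_compat_l; [exact HL|apply Hsmall, Hde].
        - apply Rmult_le_reg_r with (4 * (L + 1)); [lra|]. 
          replace (L * (H / (4 * (L + 1))) * (4 * (L + 1))) with (L * H) by (field; lra). nra. }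
      assert (X2 : Rabs (p lam t - p lam s) <= 3 * H / 4 * powR d alpha).
      { apply Rle_trans with (Rpower (P1 * Rpower lam (- alpha)) (1 - alpha)
          * Rpower (P2 * Rpower lam (1 - alpha)) alpha * powR d alpha).
        - apply holder_interpolation; try assumption.
          + apply Rmult_lt_0_compat; lra.
          + apply Rmult_lt_0_compat; [lra|apply exp_pos].
          + apply B1.
          + apply B2.
        - apply Rmult_le_compat_r; [exact Hpd|].
          rewrite <- !Rpower_mult_distr by (lra || apply exp_pos). rewrite !Rpower_mult.
          replace (Rpower P1 (1 - alpha) * Rpower lam (- alpha * (1 - alpha)) *
             (Rpower P2 alpha * Rpower lam ((1 - alpha) * alpha)))
            with (Rpower P1 (1 - alpha) * Rpower P2 alpha
               * (Rpower lam (- alpha * (1 - alpha)) * Rpower lam ((1 - alpha) * alpha))) by ring.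
          rewrite <- Rpower_plus. replace (- alpha * (1 - alpha) + (1 - alpha) * alpha) with 0 by ring.
          rewrite Rpower_O by exact Hlam. lra. }
      lra.
    + assert (X1 := Hh t s). fold d in X1. assert (X2 := B1 t s).
      assert (powR eta alpha <= powR d alpha) by (apply powR_le; lra). nra.
  - intros t. apply Rle_trans with (1 := B3 t). lra.
Qed.

(** * Density of activating speeds *)

Lemma Rabs_Rpower x y : Rabs (Rpower x y) = Rpower x y.
Proof. apply Rabs_pos_eq. left; apply exp_pos. Qed.

Lemma Rpower_le_1 x a : 1 <= x -> 0 < a -> Rpower x (- a) <= 1.
Proof.
  intros Hx Ha. rewrite <- (Rpower_O x) by lra. apply Rle_Rpower; lra.
Qed.

Section Activating_speed.
Variables (m m1 m2 : R -> R) (mu1 mu2 K : R).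
Hypothesis mu1_pos : 0 < mu1.
Hypothesis m_derive : forall t, is_derive m t (m1 t).
Hypothesis m1_derive : forall t, is_derive m1 t (m2 t).
Hypothesis m1_bound : forall t, Rabs (m1 t) <= K.
Hypothesis m2_bound : forall t, Rabs (m2 t) <= K.
Hypothesis m2_lipschitz : forall t s, Rabs (m2 t - m2 s) <= K * Rabs (t - s).
Hypothesis m_bounds : forall t, mu1 <= m t <= mu2.
Variables (alpha b delta : R).
Hypothesis alpha_01 : 0 < alpha < 1.
Hypothesis b_pos : 0 < b.
Hypothesis delta_nonneg : 0 <= delta.

(** The factor of lam^(-2 alpha) in the last term of [speed]: D and B being multiples of
    lam^(1-alpha), division by lam^2 leaves lam^(-2 alpha), while the terms containing derivatives
    of m keep powers of lam^(alpha-1), at most 1 for lam >= 1. *)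
Definition remainder (lam t : R) : R :=
  delta ^ 2 - (b * sn m lam t ^ 2 - Rpower lam (alpha - 1) * logder m m1 t) ^ 2
  + Rpower lam (alpha - 1) ^ 2 * logder' m m1 m2 t.

Definition perturbation (lam t : R) : R :=
  - 4 * b * Rpower lam (- alpha) * (gam m t * (sn m lam t * cs m lam t))
  + Rpower lam (- alpha) ^ 2 * remainder lam t.

Lemma speed_perturbation lam t : 0 < lam ->
  speed m m1 m2 (delta * Rpower lam (1 - alpha)) (b * Rpower lam (1 - alpha)) lam t
  = m t + perturbation lam t.
Proof.
  intros Hlam. unfold speed, perturbation, remainder.
  assert (E1 : Rpower lam (1 - alpha) = lam * Rpower lam (- alpha)).
  { replace (1 - alpha) with (1 + - alpha) by ring. rewrite Rpower_plus, Rpower_1; lra. }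
  assert (E2 : Rpower lam (- alpha) * Rpower lam (alpha - 1) = / lam).
  { rewrite <- Rpower_plus. replace (- alpha + (alpha - 1)) with (Ropp 1) by ring.
    rewrite Rpower_Ropp, Rpower_1; lra. }
  rewrite E1. set (x := Rpower lam (- alpha)) in *. set (z := Rpower lam (alpha - 1)) in *.
  assert (E3 : lam * (x * z) = 1) by (rewrite E2; field; lra).
  replace (logder m m1 t) with (lam * (x * z) * logder m m1 t) at 1 by (rewrite E3; ring).
  replace (logder' m m1 m2 t) with ((lam * (x * z)) ^ 2 * logder' m m1 m2 t) at 1 by (rewrite E3; ring).
  field. lra.
Qed.

Let g_pos := gam_pos m mu1 mu2 mu1_pos m_bounds.
Let Kg := K / (2 * sqrt mu1).
Let sqrt_mu1_pos : 0 < sqrt mu1 := sqrt_lt_R0 _ mu1_pos.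

Lemma K_nonneg : 0 <= K.
Proof. apply Rle_trans with (2 := m1_bound 0), Rabs_pos. Qed.

Lemma gam_upper t : Rabs (gam m t) <= sqrt mu2.
Proof.
  rewrite Rabs_pos_eq by (left; apply g_pos). apply sqrt_le_1_alt, m_bounds.
Qed.

Lemma bounded_lipschitz_gam : bounded_lipschitz (sqrt mu2) Kg (gam m).
Proof.
  apply bounded_lipschitz_derive with (fun t => m1 t / (2 * gam m t)).
  - intros t. apply (is_derive_gam m m1 mu1 mu2); assumption.
  - apply gam_upper.
  - intros t. assert (Hg := g_pos t). unfold Rdiv. rewrite Rabs_mult, (Rabs_pos_eq (/ _)).
    2:{ left; apply Rinv_0_lt_compat; lra. }
    apply Rmult_le_compat; [apply Rabs_pos|left; apply Rinv_0_lt_compat; lra|apply m1_bound|].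
    apply Rinv_le_contravar; [lra|]. apply Rmult_le_compat_l; [lra|]. apply sqrt_le_1_alt, m_bounds.
Qed.

Lemma bounded_lipschitz_sn lam : 0 <= lam -> bounded_lipschitz 1 (lam * sqrt mu2) (sn m lam).
Proof.
  intros Hlam. apply bounded_lipschitz_derive with (fun t => lam * gam m t * cs m lam t).
  - intros t. apply (is_derive_sn m m1 mu1 mu2); assumption.
  - intros t. apply sn_bound.
  - intros t. rewrite Rabs_mult, <- (Rmult_1_r (lam * sqrt mu2)).
    apply Rmult_le_compat; try apply Rabs_pos; [|apply cs_bound].
    rewrite Rabs_mult, (Rabs_pos_eq lam) by exact Hlam. apply Rmult_le_compat_l; [exact Hlam|apply gam_upper].
Qed.

Lemma bounded_lipschitz_cs lam : 0 <= lam -> bounded_lipschitz 1 (lam * sqrt mu2) (cs m lam).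
Proof.
  intros Hlam. apply bounded_lipschitz_derive with (fun t => - (lam * gam m t * sn m lam t)).
  - intros t. apply (is_derive_cs m m1 mu1 mu2); assumption.
  - intros t. apply cs_bound.
  - intros t. rewrite Rabs_Ropp, Rabs_mult, <- (Rmult_1_r (lam * sqrt mu2)).
    apply Rmult_le_compat; try apply Rabs_pos; [|apply sn_bound].
    rewrite Rabs_mult, (Rabs_pos_eq lam) by exact Hlam. apply Rmult_le_compat_l; [exact Hlam|apply gam_upper].
Qed.

Lemma oscillating_inv_m : oscillating (fun _ t => / m t).
Proof.
  apply oscillating_fixed with (/ mu1) (K / mu1 ^ 2).
  assert (Hm : forall t, / m t <= / mu1).
  { intros t. apply Rinv_le_contravar; [exact mu1_pos|apply m_bounds]. }
  assert (Hp : forall t, 0 < / m t).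
  { intros t. apply Rinv_0_lt_compat, (m_pos m mu1 mu2); assumption. }
  apply bounded_lipschitz_derive with (fun t => - m1 t / m t ^ 2).
  - intros t. apply is_derive_inv; [apply m_derive|]. apply Rgt_not_eq, (m_pos m mu1 mu2); assumption.
  - intros t. rewrite Rabs_pos_eq; [apply Hm|left; apply Hp].
  - intros t. unfold Rdiv. rewrite Rabs_mult, Rabs_Ropp, (Rabs_pos_eq (/ _)), <- !pow_inv.
    2:{ rewrite <- pow_inv. apply pow2_ge_0. }
    apply Rmult_le_compat; [apply Rabs_pos|apply pow2_ge_0|apply m1_bound|].
    apply pow_incr. split; [left; apply Hp|apply Hm].
Qed.

Lemma oscillating_m1 : oscillating (fun _ => m1).
Proof. apply oscillating_fixed with K K. apply bounded_lipschitz_derive with m2; assumption. Qed.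

Lemma oscillating_m2 : oscillating (fun _ => m2).
Proof. apply oscillating_fixed with K K. split; assumption. Qed.

Lemma oscillating_logder : oscillating (fun _ => logder m m1).
Proof.
  apply oscillating_ext with (fun lam t => (1 / 4) * (m1 t * / m t)).
  { intros lam t. unfold logder. field. apply Rgt_not_eq, (m_pos m mu1 mu2); assumption. }
  apply (oscillating_scal (fun _ t => m1 t * / m t) (fun _ => 1 / 4) (Rabs (1 / 4))); [intros; lra|].
  apply (oscillating_mult (fun _ => m1)); [apply oscillating_m1|apply oscillating_inv_m].
Qed.

Lemma oscillating_logder' : oscillating (fun _ => logder' m m1 m2).
Proof.
  (* Uses the identity logder' = m'' / (4 m) - 4 logder^2. *)
  apply oscillating_ext with (fun lam t => (1 / 4) * (m2 t * / m t) + - 4 * (logder m m1 t * logder m m1 t)).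
  { intros lam t. unfold logder', logder. field. apply Rgt_not_eq, (m_pos m mu1 mu2); assumption. }
  apply oscillating_plus.
  - apply (oscillating_scal (fun _ t => m2 t * / m t) (fun _ => 1 / 4) (Rabs (1 / 4))); [intros; lra|].
    apply (oscillating_mult (fun _ => m2)); [apply oscillating_m2|apply oscillating_inv_m].
  - apply (oscillating_scal (fun _ t => logder m m1 t * logder m m1 t) (fun _ => - 4) (Rabs (- 4))); [intros; lra|].
    apply (oscillating_mult (fun _ => logder m m1)); apply oscillating_logder.
Qed.

Lemma oscillating_sn : oscillating (sn m).
Proof.
  exists (1 + sqrt mu2). assert (X := sqrt_pos mu2). split; [lra|]. intros lam Hlam.
  apply bounded_lipschitz_weaken with (3 := bounded_lipschitz_sn lam ltac:(lra)); nra.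
Qed.

Lemma oscillating_remainder : oscillating remainder.
Proof.
  assert (Hz : forall lam, 1 <= lam -> Rabs (Rpower lam (alpha - 1)) <= 1).
  { intros lam Hlam. rewrite Rabs_Rpower. replace (alpha - 1) with (- (1 - alpha)) by ring.
    apply Rpower_le_1; lra. }
  pose (q := fun lam t => b * (sn m lam t * sn m lam t) + -1 * (Rpower lam (alpha - 1) * logder m m1 t)).
  assert (Hq : oscillating q).
  { apply oscillating_plus.
    - apply (oscillating_scal (fun lam t => sn m lam t * sn m lam t) (fun _ => b) (Rabs b)); [intros; lra|].
      apply oscillating_mult; apply oscillating_sn.
    - apply (oscillating_scal (fun lam t => Rpower lam (alpha - 1) * logder m m1 t) (fun _ => -1) (Rabs (-1)));
        [intros; lra|].
      apply (oscillating_scal (fun _ => logder m m1) _ 1 Hz), oscillating_logder. }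
  apply oscillating_ext with (fun lam t => (delta ^ 2 + -1 * (q lam t * q lam t))
    + Rpower lam (alpha - 1) * (Rpower lam (alpha - 1) * logder' m m1 m2 t)).
  { intros lam t. unfold q, remainder. ring. }
  apply oscillating_plus; [apply oscillating_plus|].
  - apply oscillating_const with (Rabs (delta ^ 2)). intros; lra.
  - apply (oscillating_scal (fun lam t => q lam t * q lam t) (fun _ => -1) (Rabs (-1))); [intros; lra|].
    apply oscillating_mult; exact Hq.
  - apply (oscillating_scal (fun lam t => Rpower lam (alpha - 1) * logder' m m1 m2 t) _ 1 Hz).
    apply (oscillating_scal (fun _ => logder' m m1 m2) _ 1 Hz), oscillating_logder'.
Qed.

(** Estimated factor by factor, the leading term accounts for 8 b of each 12 b: twice its size for
    the oscillation, one contribution each from [sn] and [cs] for the slope. The rest absorbs, for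
    large lam, the slope of [gam] and the remainder with its additional factor lam^(-alpha). *)
Lemma perturbation_estimates : exists P3, 0 < P3 /\ for_large (fun lam =>
    (forall t, Rabs (perturbation lam t) <= P3 * Rpower lam (- alpha)) /\
    (forall t s, Rabs (perturbation lam t - perturbation lam s)
        <= 12 * b * sqrt mu2 * Rpower lam (- alpha)) /\
    (forall t s, Rabs (perturbation lam t - perturbation lam s)
        <= 12 * b * mu2 * Rpower lam (1 - alpha) * Rabs (t - s))).
Proof.
  assert (Hmu2 : 0 < mu2) by (destruct (m_bounds 0); lra).
  assert (Hsq : 0 < sqrt mu2) by (apply sqrt_lt_R0, Hmu2).
  destruct oscillating_remainder as (C & HC & Hrem).
  assert (HKg : 0 <= Kg).
  { apply Rmult_le_pos; [apply K_nonneg|]. left; apply Rinv_0_lt_compat; lra. }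
  exists (4 * b * sqrt mu2 + C + 1).
  assert (0 < b * sqrt mu2) by (apply Rmult_lt_0_compat; lra).
  assert (0 < b * mu2) by (apply Rmult_lt_0_compat; lra).
  split; [lra|].
  assert (T1 : 0 < 2 * b * sqrt mu2 / (C + 1)) by (apply Rdiv_lt_0_compat; lra).
  assert (T2 : 0 < 2 * b * mu2 / (C + 1)) by (apply Rdiv_lt_0_compat; lra).
  apply for_large_impl with (2 := for_large_and _ _ (for_large_gt 1) (for_large_and _ _ (for_large_gt (2 * Kg / mu2))
    (for_large_and _ _ (for_large_Rpower_small alpha _ (proj1 alpha_01) T1)
       (for_large_Rpower_small alpha _ (proj1 alpha_01) T2)))).
  intros lam (Hlam & HlK & S1 & S2).
  assert (Hx : 0 < Rpower lam (- alpha)) by apply exp_pos.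
  assert (Hx1 : Rpower lam (- alpha) <= 1) by (apply Rpower_le_1; lra).
  assert (E1 : Rpower lam (1 - alpha) = lam * Rpower lam (- alpha)).
  { replace (1 - alpha) with (1 + - alpha) by ring. rewrite Rpower_plus, Rpower_1; lra. }
  rewrite E1. unfold perturbation. set (x := Rpower lam (- alpha)) in *.
  assert (S1' : x * C <= 2 * b * sqrt mu2).
  { apply Rmult_le_compat_r with (r := C + 1) in S1; [|lra].
    replace (2 * b * sqrt mu2 / (C + 1) * (C + 1)) with (2 * b * sqrt mu2) in S1 by (field; lra). nra. }
  assert (S2' : x * C <= 2 * b * mu2).
  { apply Rmult_le_compat_r with (r := C + 1) in S2; [|lra].
    replace (2 * b * mu2 / (C + 1) * (C + 1)) with (2 * b * mu2) in S2 by (field; lra). nra. }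
  assert (HlK' : 2 * Kg <= mu2 * lam).
  { apply Rmult_lt_compat_r with (r := mu2) in HlK; [|lra].
    replace (2 * Kg / mu2 * mu2) with (2 * Kg) in HlK by (field; lra). lra. }
  assert (Hlam0 : 0 <= lam) by lra.
  assert (HG := bounded_lipschitz_mult _ _ _ _ _ _ bounded_lipschitz_gam
    (bounded_lipschitz_mult _ _ _ _ _ _ (bounded_lipschitz_sn lam Hlam0) (bounded_lipschitz_cs lam Hlam0))).
  assert (Hp := bounded_lipschitz_plus _ _ _ _ _ _
    (bounded_lipschitz_mult _ _ _ _ _ _ (bounded_lipschitz_const (- 4 * b * x)) HG)
    (bounded_lipschitz_mult _ _ _ _ _ _ (bounded_lipschitz_const (x ^ 2)) (Hrem lam ltac:(lra)))).
  assert (A1 : Rabs (- 4 * b * x) = 4 * b * x).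
  { replace (- 4 * b * x) with (- (4 * b * x)) by ring. rewrite Rabs_Ropp. apply Rabs_pos_eq.
    repeat apply Rmult_le_pos; lra. }
  rewrite A1, (Rabs_pos_eq (x ^ 2)) in Hp by apply pow2_ge_0.
  destruct Hp as [Hp1 Hp2]. cbv beta in Hp1, Hp2.
  assert (HxC : x ^ 2 * C <= C * x).
  { replace (x ^ 2 * C) with (C * x * x) by ring. rewrite <- (Rmult_1_r (C * x)) at 2.
    apply Rmult_le_compat_l; [apply Rmult_le_pos|]; lra. }
  assert (HxC1 : x ^ 2 * C <= 2 * b * sqrt mu2 * x).
  { replace (x ^ 2 * C) with (x * C * x) by ring. apply Rmult_le_compat_r; lra. }
  split; [|split].
  - intros t. apply Rle_trans with (1 := Hp1 t). lra.
  - intros t s. apply Rle_trans with (1 := Rabs_triang _ _). rewrite Rabs_Ropp.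
    assert (X1 := Hp1 t). assert (X2 := Hp1 s). cbv beta in X1, X2. lra.
  - intros t s. apply Rle_trans with (1 := Hp2 t s). apply Rmult_le_compat_r; [apply Rabs_pos|].
    assert (E2 : sqrt mu2 * sqrt mu2 = mu2) by (apply sqrt_sqrt; lra).
    assert (X1 : x ^ 2 * (C * lam) <= 2 * b * mu2 * x * lam).
    { replace (x ^ 2 * (C * lam)) with (x * C * (x * lam)) by ring.
      replace (2 * b * mu2 * x * lam) with (2 * b * mu2 * (x * lam)) by ring.
      apply Rmult_le_compat_r; [apply Rmult_le_pos; lra|exact S2']. }
    assert (X2 : 4 * b * x * Kg <= 2 * b * x * (mu2 * lam)).
    { replace (4 * b * x * Kg) with (2 * b * x * (2 * Kg)) by ring.
      apply Rmult_le_compat_l; [repeat apply Rmult_le_pos; lra|exact HlK']. }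
    replace (4 * b * x * (sqrt mu2 * (1 * (lam * sqrt mu2) + lam * sqrt mu2 * 1) + Kg * (1 * 1)))
      with (8 * b * x * lam * (sqrt mu2 * sqrt mu2) + 4 * b * x * Kg) by ring.
    rewrite E2. assert (0 <= b * mu2 * lam * x) by (repeat apply Rmult_le_pos; lra). lra.
Qed.

(** On the time interval (b/2 - delta) t >= a0, so the exponent contains at least 2 a0
    lam^(1-alpha). One half pays for the term with the logarithm, as 1 / ln(2 + lam) <= a0 / 4; the
    other pays for [C0], which collects all that stays bounded in lam. *)
Lemma sol_energy_large n : delta < b / 2 -> for_large (fun lam =>
  forall t, / (INR n + 1) <= t <= INR n + 1 ->
  4 * (4 ^ n * exp (4 * (Rpower lam (1 - alpha) / ln (2 + lam)))) <=
  energy lam (sol m (delta * Rpower lam (1 - alpha)) (b * Rpower lam (1 - alpha)) lam)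
    (sol' m m1 (delta * Rpower lam (1 - alpha)) (b * Rpower lam (1 - alpha)) lam) t).
Proof.
  intros Hdb. assert (Hn : 0 <= INR n) by apply pos_INR.
  assert (Hmu2 : mu1 <= mu2) by (destruct (m_bounds 0); lra).
  destruct (sn2_int_lower m m1 mu1 mu2 K mu1_pos m_derive m1_bound m_bounds) as (KJ & HKJ & HJ).
  destruct oscillating_logder as (Kl & HKl & Hl). specialize (Hl 1 (Rle_refl _)). destruct Hl as [Hl _].
  set (kap := Rmin mu1 1 / (2 * mu2)).
  assert (Hkap : 0 < kap).
  { apply Rdiv_lt_0_compat; [apply Rmin_pos; lra|lra]. }
  set (a0 := (b / 2 - delta) / (INR n + 1)).
  assert (Ha0 : 0 < a0) by (apply Rdiv_lt_0_compat; lra).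
  set (L0 := (ln mu2 - ln mu1) / 4).
  set (C0 := ln (4 * 4 ^ n / kap) + 2 * (b * KJ * (INR n + 2)) + 2 * L0).
  assert (T1 : 0 < a0 / 4) by lra.
  assert (T2 : 0 < / (4 * (b + delta))) by (apply Rinv_0_lt_compat; lra).
  apply for_large_impl with (2 := for_large_and _ _ (for_large_gt 1) (for_large_and _ _ (for_large_gt (4 * Kl))
    (for_large_and _ _ (for_large_Rpower_small alpha _ (proj1 alpha_01) T2)
    (for_large_and _ _ (for_large_inv_ln _ T1)
       (for_large_Rpower_large (1 - alpha) (C0 / a0) ltac:(lra)))))).
  intros lam (Hlam & HlK & S1 & S2 & S3) t Ht.
  assert (Ht0 : 0 < t) by (assert (0 < / (INR n + 1)) by (apply Rinv_0_lt_compat; lra); lra).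
  assert (Hx : 0 < Rpower lam (- alpha)) by apply exp_pos.
  assert (Hx1 : Rpower lam (- alpha) <= 1) by (apply Rpower_le_1; lra).
  assert (E1 : Rpower lam (1 - alpha) = lam * Rpower lam (- alpha)).
  { replace (1 - alpha) with (1 + - alpha) by ring. rewrite Rpower_plus, Rpower_1; lra. }
  set (Y := Rpower lam (1 - alpha)) in *. set (x := Rpower lam (- alpha)) in *.
  assert (HY : 0 < Y) by apply exp_pos.
  assert (HbY : 0 <= b * Y) by (apply Rmult_le_pos; lra).
  refine (Rle_trans _ _ _ _ (sol_energy_lower m m1 mu1 mu2 mu1_pos m_bounds (delta * Y) (b * Y) lam t KJ
    _ _ _ (HJ lam t _ _) _)); try lra.
  - fold kap L0.
    replace (4 * (4 ^ n * exp (4 * (Y / ln (2 + lam)))))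
      with (kap * (exp (ln (4 * 4 ^ n / kap)) * exp (4 * (Y / ln (2 + lam))))).
    2:{ rewrite exp_ln; [field; lra|]. apply Rdiv_lt_0_compat; [|exact Hkap].
        apply Rmult_lt_0_compat; [lra|apply pow_lt; lra]. }
    apply Rmult_le_compat_l; [lra|]. rewrite <- exp_plus. apply exp_le_exp.
    assert (X1 : Y / ln (2 + lam) <= Y * (a0 / 4)) by (apply Rmult_le_compat_l; [lra|exact S2]).
    assert (X2 : C0 <= a0 * Y).
    { apply Rmult_le_compat_l with (r := a0) in S3; [|lra].
      replace (a0 * (C0 / a0)) with C0 in S3 by (field; lra). exact S3. }
    (* The averaging error is O(1 / lam) and is multiplied by B, of order lam^(1-alpha), so the
       product stays bounded. *)
    assert (X3 : b * Y * KJ * (1 + t) / lam <= b * KJ * (INR n + 2)).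
    { replace (b * Y * KJ * (1 + t) / lam) with (b * KJ * (x * (1 + t))) by (rewrite E1; field; lra).
      apply Rmult_le_compat_l; [apply Rmult_le_pos; lra|]. nra. }
    assert (X4 : a0 * Y <= (b * Y / 2 - delta * Y) * t).
    { replace ((b * Y / 2 - delta * Y) * t) with ((b / 2 - delta) * t * Y) by field.
      apply Rmult_le_compat_r; [lra|]. unfold a0, Rdiv at 1. apply Rmult_le_compat_l; lra. }
    unfold C0 in X2. lra.
  (* B and D together contribute at most lam / 4 to |rate|, and [logder] at most lam / 4. *)
  - apply Rle_trans with ((lam / 2) ^ 2); [|nra].
    apply pow_maj_Rabs. unfold rate.
    assert (X1 : (b + delta) * x <= / 4).
    { apply Rle_trans with ((b + delta) * / (4 * (b + delta))); [apply Rmult_le_compat_l; lra|].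
      right. field. lra. }
    assert (X2 : (b * Y + delta * Y) <= lam / 4) by (rewrite E1; nra).
    assert (X3 : 0 <= sn m lam t ^ 2 <= 1).
    { split; [apply pow2_ge_0|]. rewrite <- (pow1 2). apply pow_maj_Rabs, sn_bound. }
    assert (X4 : 0 <= b * Y * sn m lam t ^ 2 <= b * Y).
    { split; [apply Rmult_le_pos; lra|]. rewrite <- (Rmult_1_r (b * Y)) at 2. apply Rmult_le_compat_l; lra. }
    assert (X5 := Hl t). apply Rabs_le_between in X5.
    assert (0 <= delta * Y) by (apply Rmult_le_pos; lra).
    apply Rabs_le_between. lra.
Qed.
End Activating_speed.

(** Half of eps goes to the regularization and half to the perturbation. Having a speed for every
    large lam is what allows components of arbitrarily high index to be activated. *)
Lemma activating_speed mu1 mu2 alpha H delta c eps n :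
  0 < mu1 -> mu1 < mu2 -> 0 < alpha < 1 -> 0 < H ->
  0 <= delta -> delta < H / (32 * Rpower mu2 ((1 + alpha) / 2)) ->
  PS mu1 mu2 alpha H c -> 0 < eps ->
  for_large (fun lam => exists c' u v w : R -> R,
    PS mu1 mu2 alpha H c' /\ unif_close c c' eps /\
    oscillator_solution (delta * Rpower lam (1 - alpha)) lam c' u v w /\ u 0 = 0 /\ v 0 = 1 /\
    forall t, / (INR n + 1) <= t <= INR n + 1 ->
    4 * (4 ^ n * exp (4 * (Rpower lam (1 - alpha) / ln (2 + lam)))) <= energy lam u v t).
Proof.
  intros Hmu1 Hmu Ha HH Hd Hd' Hc Heps.
  destruct (PS_regularization mu1 mu2 alpha H c (eps / 2) Hmu1 Hmu Ha HH Hc ltac:(lra))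
    as (m & m1 & m2 & K & theta & Hth & D1 & D2 & B1 & B2 & L2 & Bm & Hm & Hclose).
  assert (Bm' : forall t, mu1 <= m t <= mu2) by (intros t; destruct (Bm t); lra).
  set (X := Rpower mu2 ((1 + alpha) / 2)) in *. assert (HX : 0 < X) by apply exp_pos.
  (* This makes the interpolated constant 12 b X equal to 3 H / 4, and b / 2 equal to the bound
     assumed on delta. *)
  set (b := H / (16 * X)). assert (Hb : 0 < b) by (apply Rdiv_lt_0_compat; lra).
  assert (Hdb : delta < b / 2).
  { replace (b / 2) with (H / (32 * X)) by (unfold b; field; lra). exact Hd'. }
  destruct (perturbation_estimates m m1 m2 mu1 mu2 K Hmu1 D1 D2 B1 B2 L2 Bm' alpha b delta Ha Hb)
    as (P3 & HP3 & Hpert).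
  assert (Hsq : 0 < sqrt mu2) by (apply sqrt_lt_R0; lra).
  assert (HP : Rpower (12 * b * sqrt mu2) (1 - alpha) * Rpower (12 * b * mu2) alpha <= 3 * H / 4).
  { right. rewrite <- (Rpower_mult_distr (12 * b) (sqrt mu2)), <- (Rpower_mult_distr (12 * b) mu2) by lra. rewrite <- Rpower_sqrt by lra. rewrite Rpower_mult.
    transitivity ((Rpower (12 * b) (1 - alpha) * Rpower (12 * b) alpha) *
      (Rpower mu2 (/ 2 * (1 - alpha)) * Rpower mu2 alpha)); [ring|].
    rewrite <- !Rpower_plus. replace (1 - alpha + alpha) with 1 by ring.
    rewrite Rpower_1 by lra. replace (/ 2 * (1 - alpha) + alpha) with ((1 + alpha) / 2) by field.
    fold X. unfold b. field. lra. }
  assert (HK : 0 <= K) by (apply Rle_trans with (2 := B1 0), Rabs_pos).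
  assert (H2 := PS_perturbation mu1 mu2 alpha H theta K (12 * b * sqrt mu2) (12 * b * mu2) P3 m
    (perturbation m m1 m2 alpha b delta) (eps / 2) Ha HH Hth HK
    ltac:(apply Rmult_lt_0_compat; lra) ltac:(apply Rmult_lt_0_compat; lra) HP3 ltac:(lra) HP Bm Hm
    (lipschitz_of_derive m m1 K D1 B1) Hpert).
  assert (H3 := sol_energy_large m m1 m2 mu1 mu2 K Hmu1 D1 D2 B1 B2 Bm' alpha b delta Ha Hb Hd n Hdb).
  apply for_large_impl with (2 := for_large_and _ _ (for_large_gt 1) (for_large_and _ _ Hpert (for_large_and _ _ H2 H3))).
  intros lam (Hlam & (_ & _ & Hlip) & (HPS & Hsmall) & HE).
  set (Dp := delta * Rpower lam (1 - alpha)) in *. set (Bp := b * Rpower lam (1 - alpha)) in *.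
  exists (speed m m1 m2 Dp Bp lam), (sol m Dp Bp lam), (sol' m m1 Dp Bp lam), (sol'' m m1 m2 Dp Bp lam).
  assert (Hsp : forall t, speed m m1 m2 Dp Bp lam t = m t + perturbation m m1 m2 alpha b delta lam t).
  { intros t. apply speed_perturbation. lra. }
  split; [|split; [|split; [|split; [|split]]]].
  - destruct HPS as [G1 G2]. split; intros; rewrite !Hsp; auto.
  - intros t Ht. rewrite Hsp. specialize (Hclose t Ht). specialize (Hsmall t).
    apply Rabs_le_between in Hclose. apply Rabs_le_between in Hsmall. apply Rabs_le_between. lra.
  - apply (sol_oscillator m m1 m2 mu1 mu2); try assumption; [lra|].
    set (L := K + 12 * b * mu2 * Rpower lam (1 - alpha)).
    assert (HL : 0 <= L).
    { apply Rplus_le_le_0_compat; [exact HK|].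
      apply Rmult_le_pos; [apply Rmult_le_pos; lra|left; apply exp_pos]. }
    apply continuous_of_modulus with (fun x => L * x).
    + intros e He. exists (e / (L + 1)). split; [apply Rdiv_lt_0_compat; lra|].
      intros x Hx. apply Rle_trans with (L * (e / (L + 1))); [apply Rmult_le_compat_l; assumption|].
      apply Rmult_le_reg_r with (L + 1); [lra|].
      replace (L * (e / (L + 1)) * (L + 1)) with (L * e) by (field; lra). nra.
    + intros t s. rewrite !Hsp.
      replace (_ - _) with ((m t - m s) + (perturbation m m1 m2 alpha b delta lam t
        - perturbation m m1 m2 alpha b delta lam s)) by ring.
      apply Rle_trans with (1 := Rabs_triang _ _). unfold L. rewrite Rmult_plus_distr_r.
      apply Rplus_le_compat; [apply (lipschitz_of_derive m m1 K D1 B1)|apply Hlip].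
  - apply sol_0.
  - apply (sol'_0 m m1 mu1 mu2); try assumption; lra.
  - exact HE.
Qed.

(** * Activated components *)

(* Quantifying over all solutions makes uniqueness for the Cauchy problem unnecessary. *)
Definition activated (D lam phi : R) (c : R -> R) (n : nat) : Prop :=
  forall u v w, oscillator_solution D lam c u v w -> u 0 = 0 -> v 0 = 1 ->
  forall t, / (INR n + 1) <= t <= INR n + 1 -> 4 ^ n * exp (4 * phi) <= energy lam u v t.

(** Both the threshold 4^n and the time interval grow with n; the greedy selection relies on this
    monotonicity. *)
Lemma activated_le D lam phi c k n : (k <= n)%nat -> activated D lam phi c n -> activated D lam phi c k.
Proof.
  intros Hkn Hn u v w Hs Hu Hv t Ht.
  assert (Hk : 0 <= INR k) by apply pos_INR. apply le_INR in Hkn as HR.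
  apply Rle_trans with (4 ^ n * exp (4 * phi)).
  - apply Rmult_le_compat_r; [left; apply exp_pos|]. apply Rle_pow; [lra|exact Hkn].
  - apply (Hn u v w Hs Hu Hv). split; [|lra].
    apply Rle_trans with (2 := proj1 Ht). apply Rinv_le_contravar; lra.
Qed.

(** The factor 4 in the hypothesis is what [energy_stability] gives up. The radius depends on lam, n
    and the maximum of |u|, which is harmless because one component at a time is concerned. *)
Lemma activated_stable mu D lam phi c u v w n :
  0 <= D -> 0 <= lam -> 0 <= mu -> oscillator_solution D lam c u v w -> u 0 = 0 -> v 0 = 1 ->
  (forall t, / (INR n + 1) <= t <= INR n + 1 -> 4 * (4 ^ n * exp (4 * phi)) <= energy lam u v t) ->
  exists eps, 0 < eps /\ forall c', (forall t, 0 <= t -> 0 <= c' t <= mu) ->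
    unif_close c c' eps -> activated D lam phi c' n.
Proof.
  intros HD Hlam Hmu Hs Hu Hv HE.
  assert (Hn : 0 <= INR n) by apply pos_INR. set (T := INR n + 1) in *.
  assert (HT : 0 < T) by (unfold T; lra).
  assert (HcU := cont_nonneg_extend u (deriv_nonneg_cont_nonneg _ _ (proj1 Hs))).
  destruct (continuity_ab_maj (fun t => Rabs (u (Rmax 0 t))) 0 T) as [Mx [HMx _]]; [lra| |].
  { intros t _. apply continuity_pt_filterlim.
    apply (continuous_comp (fun t => u (Rmax 0 t)) Rabs); [apply HcU|apply continuous_Rabs]. }
  set (M := Rabs (u (Rmax 0 Mx))) in *.
  set (X := 4 ^ n * exp (4 * phi)) in *.
  assert (HX : 0 < X) by (apply Rmult_lt_0_compat; [apply pow_lt; lra|apply exp_pos]).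
  set (Z := lam ^ 4 * M ^ 2 * T * exp ((lam * (1 + mu) + 1) * T)).
  assert (HZ : 0 <= Z).
  { apply Rmult_le_pos; [|left; apply exp_pos]. apply Rmult_le_pos; [|lra].
    apply Rmult_le_pos; [apply pow_le, Hlam|apply pow2_ge_0]. }
  (* Ensures eps^2 Z <= eps (Z + 1) <= X, the first inequality by eps <= 1. *)
  set (eps := Rmin 1 (X / (Z + 1))).
  assert (Heps : 0 < eps) by (apply Rmin_pos; [lra|apply Rdiv_lt_0_compat; lra]).
  assert (eps <= 1) by apply Rmin_l.
  assert (HepsX : eps * (Z + 1) <= X).
  { apply Rle_trans with (X / (Z + 1) * (Z + 1)); [apply Rmult_le_compat_r; [lra|apply Rmin_r]|].
    right; field; lra. }
  exists eps. split; [exact Heps|]. intros c' Hc' Hclose u' v' w' Hs' Hu' Hv' t Ht.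
  apply (energy_stability D lam M mu c c' u' v' w' u v w T X (/ T)) with eps; try lra; try assumption.
  - left; apply Rinv_0_lt_compat, HT.
  - intros s Hsr. specialize (HMx s Hsr). simpl in HMx. rewrite (Rmax_right 0 s) in HMx by lra. exact HMx.
  - replace (_ * _) with (eps ^ 2 * Z) by (unfold Z; ring).
    apply Rle_trans with (2 := HepsX).
    replace (eps ^ 2 * Z) with (eps * (eps * Z)) by ring. apply Rmult_le_compat_l; [lra|].
    assert (eps * Z <= 1 * Z) by (apply Rmult_le_compat_r; lra). lra.
Qed.

(** The substitution u = exp(- D t) y removes the damping and leaves y'' + (c lam^2 - D^2) y = 0,
    whose coefficient is continuous and bounded. *)
Lemma oscillator_solution_exists D lam mu1 mu2 alpha H c :
  0 < alpha < 1 -> 0 < H -> PS mu1 mu2 alpha H c ->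
  exists u v w, oscillator_solution D lam c u v w /\ u 0 = 0 /\ v 0 = 1.
Proof.
  intros Ha HH [Hb Hh].
  set (ce := fun t => c (Rmax 0 t)).
  assert (Hce : forall t, continuous ce t).
  { apply cont_nonneg_extend. intros t Ht e He.
    destruct (powR_small alpha (e / (2 * H))) as [eta [Heta Hs]]; [lra|apply Rdiv_lt_0_compat; lra|].
    exists eta. split; [exact Heta|]. intros t' Ht' Hd.
    apply Rle_lt_trans with (1 := Hh t' t Ht' Ht).
    apply Rle_lt_trans with (H * (e / (2 * H))).
    - apply Rmult_le_compat_l; [lra|]. apply Hs; lra.
    - replace (H * (e / (2 * H))) with (e / 2) by (field; lra). lra. }
  set (q := fun t => ce t * lam ^ 2 + - D ^ 2).
  assert (Hq : forall t, continuous q t).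
  { intros t. apply (continuous_comp ce (fun x => x * lam ^ 2 + - D ^ 2)); [apply Hce|].
    eapply is_derive_continuous. auto_derive; [exact I|reflexivity]. }
  assert (HqB : forall t, Rabs (q t) <= (Rabs mu1 + Rabs mu2) * lam ^ 2 + D ^ 2).
  { intros t. unfold q, ce. specialize (Hb (Rmax 0 t) (Rmax_l _ _)).
    apply Rle_trans with (1 := Rabs_triang _ _). rewrite Rabs_mult.
    rewrite (Rabs_pos_eq (lam ^ 2)), Rabs_Ropp, (Rabs_pos_eq (D ^ 2)) by apply pow2_ge_0.
    apply Rplus_le_compat_r. apply Rmult_le_compat_r; [apply pow2_ge_0|].
    unfold Rabs; repeat destruct Rcase_abs; lra. }
  destruct (oscillator_exists q _ Hq HqB) as (y & z & Hy0 & Hz0 & Hy & Hz).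
  set (u := fun t => exp (- D * t) * y t).
  set (v := fun t => exp (- D * t) * (z t - D * y t)).
  set (w := fun t => - (2 * D * v t) - ce t * lam ^ 2 * u t).
  assert (Hu : forall t, 0 <= t -> is_derive u t (v t)).
  { intros t Ht. unfold u, v. auto_derive.
    - eexists; apply Hy, Ht.
    - rewrite (is_derive_unique (fun x : R => y x) _ _ (Hy t Ht)). ring. }
  assert (Hv : forall t, 0 <= t -> is_derive v t (w t)).
  { intros t Ht. unfold w, u, v. auto_derive.
    - split; [eexists; apply Hz, Ht|split; [eexists; apply Hy, Ht|exact I]].
    - rewrite (is_derive_unique (fun x : R => y x) _ _ (Hy t Ht)).
      rewrite (is_derive_unique (fun x : R => z x) _ _ (Hz t Ht)). unfold q. ring. }
  exists u, v, w. split; [split; [|split; [|split]]|split].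
  - apply is_derive_deriv_nonneg, Hu.
  - apply is_derive_deriv_nonneg, Hv.
  - apply continuous_cont_nonneg. intros t Ht. unfold w.
    apply (continuous_minus (fun t => - (2 * D * v t)) (fun t => ce t * lam ^ 2 * u t)).
    + apply (continuous_comp v (fun x => - (2 * D * x))).
      * exact (is_derive_continuous _ _ _ (Hv t Ht)).
      * eapply is_derive_continuous. auto_derive; [exact I|reflexivity].
    + apply (continuous_mult (fun t => ce t * lam ^ 2) u).
      * apply (continuous_mult ce (fun _ => lam ^ 2)); [apply Hce|apply continuous_const].
      * exact (is_derive_continuous _ _ _ (Hu t Ht)).
  - intros t Ht. unfold w, ce. rewrite Rmax_right by exact Ht. ring.
  - unfold u. rewrite Hy0. ring.
  - unfold v. rewrite Hy0, Hz0, Rmult_0_r, exp_0. ring.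
Qed.

(** * Greedy selection of a sparse sequence of components *)

Section Greedy_selection.
Variable P : nat -> nat -> Prop.
Hypothesis P_decreasing : forall k n i, (k <= n)%nat -> P n i -> P k i.
Hypothesis P_frequent : forall n, exists i, (n <= i)%nat /\ P n i.

Definition chosen (k i : nat) : bool := if excluded_middle_informative (P k i) then true else false.

(** The number of indices chosen before i, which is also the requirement sought next: i is chosen if
    it satisfies [P] at the current level. *)
Fixpoint level (i : nat) : nat :=
  match i with
  | O => O
  | S i => if chosen (level i) i then S (level i) else level i
  end.

Definition weight (i : nat) : R := if chosen (level i) i then / 4 ^ level i else 0.

(** No level is chosen twice, so the geometric series of 4^(-k) dominates the sum. *)
Lemma weight_sum N : sum_f_R0 weight N <= 4 / 3.
Proof.
  enough (sum_f_R0 weight N = 4 / 3 * (1 - / 4 ^ level (S N))).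
  { assert (0 < / 4 ^ level (S N)) by (apply Rinv_0_lt_compat, pow_lt; lra). lra. }
  (* A chosen index raises the level by one and any other leaves it unchanged, so the weights
     telescope. *)
  assert (Hstep : forall i, weight i = 4 / 3 * (/ 4 ^ level i - / 4 ^ level (S i))).
  { intros i. unfold weight. simpl level. destruct (chosen (level i) i); [|ring].
    simpl pow. field. apply pow_nonzero. lra. }
  induction N as [|N IH].
  - change (sum_f_R0 weight 0) with (weight 0). rewrite Hstep. change (level 0) with O. rewrite pow_O, Rinv_1. reflexivity.
  - change (sum_f_R0 weight (S N)) with (sum_f_R0 weight N + weight (S N)). rewrite IH, Hstep. ring.
Qed.

Lemma weight_nonneg i : 0 <= weight i.
Proof.
  unfold weight. destruct (chosen (level i) i); [|lra]. left. apply Rinv_0_lt_compat, pow_lt. lra.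
Qed.

Lemma level_mono i j : (i <= j)%nat -> (level i <= level j)%nat.
Proof.
  induction 1 as [|j _ IH]; [lia|]. simpl. destruct (chosen (level j) j); lia.
Qed.

Lemma level_le i : (level i <= i)%nat.
Proof. induction i as [|i IH]; simpl; [lia|]. destruct (chosen (level i) i); lia. Qed.

(* If the level did not increase before an index at which [P (level i)] holds, that index would be
   selected. *)
Lemma level_increases i : exists j, (i <= j)%nat /\ level j = level i /\ P (level j) j.
Proof.
  destruct (P_frequent i) as [j0 [Hij Hj0]].
  assert (Hj : P (level i) j0) by (apply P_decreasing with i; [apply level_le|exact Hj0]).
  enough (Hgen : forall d i, (i + d = j0)%nat -> P (level i) j0 ->
     exists j, (i <= j)%nat /\ level j = level i /\ P (level j) j).
  { apply (Hgen (j0 - i)%nat); [lia|exact Hj]. }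
  clear. induction d as [|d IH]; intros i Hd HP.
  - replace j0 with i in HP by lia. exists i. auto.
  - destruct (chosen (level i) i) eqn:E.
    + exists i. split; [lia|split; [reflexivity|]].
      unfold chosen in E. destruct (excluded_middle_informative (P (level i) i)); [assumption|discriminate].
    + assert (El : level (S i) = level i) by (simpl; rewrite E; reflexivity).
      destruct (IH (S i)) as (j & H1 & H2 & H3); [lia|rewrite El; exact HP|].
      exists j. split; [lia|]. split; [congruence|exact H3].
Qed.

Lemma level_unbounded k : exists i, (k <= level i)%nat.
Proof.
  induction k as [|k [i Hi]]; [exists O; lia|].
  destruct (level_increases i) as (j & Hij & Hl & HP). exists (S j). simpl. unfold chosen.
  destruct (excluded_middle_informative (P (level j) j)); [|contradiction]. lia.
Qed.

Lemma chosen_frequent N : exists i, (N <= i)%nat /\ (N <= level i)%nat /\ P (level i) i /\ weight i = / 4 ^ level i.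
Proof.
  destruct (level_unbounded N) as [i0 Hi0].
  (* Starting beyond [i0] makes the level large, starting beyond [N] the index. *)
  destruct (level_increases (Nat.max N i0)) as (j & Hij & Hl & HP).
  assert (Hm := level_mono i0 j ltac:(lia)).
  exists j. split; [lia|split; [lia|split; [exact HP|]]].
  unfold weight, chosen. destruct (excluded_middle_informative (P (level j) j)); [reflexivity|contradiction].
Qed.

Lemma weight_summable : summable weight.
Proof.
  destruct (ex_finite_lim_seq_incr (sum_f_R0 weight) (4 / 3)) as [l Hl].
  - intros n. simpl. assert (X := weight_nonneg (S n)). lra.
  - apply weight_sum.
  - exists l. intros e He. apply is_lim_seq_Reals in Hl. destruct (Hl e He) as [N HN]. exists N. exact HN.
Qed.
End Greedy_selection.

Lemma summable_ext f g : (forall i, f i = g i) -> summable f -> summable g.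
Proof.
  intros E [l Hl]. exists l. intros e He. destruct (Hl e He) as [N HN]. exists N. intros n Hn.
  rewrite (sum_eq g f) by (intros; symmetry; apply E). apply HN, Hn.
Qed.

Lemma summable_0 : summable (fun _ => 0).
Proof.
  exists 0. intros e He. exists O. intros n _. rewrite sum_eq_R0 by reflexivity.
  unfold Rdist. rewrite Rminus_diag, Rabs_R0. exact He.
Qed.

Lemma summable_eventually_small f e : summable f -> 0 < e -> exists N, forall n, (N <= n)%nat -> f n < e.
Proof.
  intros [l Hl] He. apply is_series_Reals in Hl.
  assert (H0 := ex_series_lim_0 f (ex_intro _ l Hl)). apply is_lim_seq_Reals in H0.
  destruct (H0 e He) as [N HN]. exists N. intros n Hn. specialize (HN n Hn).
  unfold Rdist in HN. rewrite Rminus_0_r in HN. apply Rle_lt_trans with (1 := Rle_abs _) (2 := HN).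
Qed.

(** * Residuality *)

Lemma deriv_nonneg_scal a f f' : deriv_nonneg f f' ->
  deriv_nonneg (fun t => a * f t) (fun t => a * f' t).
Proof.
  intros Hf t Ht e He. assert (Ha : 0 < Rabs a + 1) by (assert (X := Rabs_pos a); lra).
  destruct (Hf t Ht (e / (Rabs a + 1))) as [d [Hd H]]; [apply Rdiv_lt_0_compat; lra|].
  exists d. split; [exact Hd|]. intros h Hh Hhd Hth. specialize (H h Hh Hhd Hth).
  replace ((a * f (t + h) - a * f t) / h - a * f' t) with (a * ((f (t + h) - f t) / h - f' t))
    by (field; exact Hh).
  rewrite Rabs_mult. set (q := Rabs (_ / h - _)) in *.
  assert (Hq : 0 <= q) by apply Rabs_pos.
  apply Rle_lt_trans with ((Rabs a + 1) * q); [nra|].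
  replace e with ((Rabs a + 1) * (e / (Rabs a + 1))) by (field; lra). apply Rmult_lt_compat_l; lra.
Qed.

Lemma cont_nonneg_scal a f : cont_nonneg f -> cont_nonneg (fun t => a * f t).
Proof.
  intros Hf t Ht e He. assert (Ha : 0 < Rabs a + 1) by (assert (X := Rabs_pos a); lra).
  destruct (Hf t Ht (e / (Rabs a + 1))) as [d [Hd H]]; [apply Rdiv_lt_0_compat; lra|].
  exists d. split; [exact Hd|]. intros t' Ht' Htd. specialize (H t' Ht' Htd).
  rewrite <- Rmult_minus_distr_l, Rabs_mult. set (q := Rabs (f t' - f t)) in *.
  assert (Hq : 0 <= q) by apply Rabs_pos.
  apply Rle_lt_trans with ((Rabs a + 1) * q); [nra|].
  replace e with ((Rabs a + 1) * (e / (Rabs a + 1))) by (field; lra). apply Rmult_lt_compat_l; lra.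
Qed.

Lemma unif_close_trans c1 c2 c3 e1 e2 :
  unif_close c1 c2 e1 -> unif_close c2 c3 e2 -> unif_close c1 c3 (e1 + e2).
Proof.
  intros H1 H2 t Ht. replace (c1 t - c3 t) with ((c1 t - c2 t) + (c2 t - c3 t)) by ring.
  apply Rle_trans with (1 := Rabs_triang _ _). apply Rplus_le_compat; auto.
Qed.

(** The robust form of a property is its interior relative to X: openness comes for free, and only
    density remains to be proved for the sets of the theorem. *)
Lemma open_robust (X P : (R -> R) -> Prop) :
  open_in X (fun c => exists eps, 0 < eps /\ forall c', X c' -> unif_close c c' eps -> P c').
Proof.
  intros c _ (eps & Heps & HP). exists (eps / 2). split; [lra|]. intros c' _ Hcc'.
  exists (eps / 2). split; [lra|]. intros c'' Hc'' Hcc''. apply HP; [exact Hc''|].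
  replace eps with (eps / 2 + eps / 2) by field. exact (unif_close_trans _ _ _ _ _ Hcc' Hcc'').
Qed.

(* Each activated component, started with the velocity [sqrt (weight i) * exp (- phi i)], contributes
   [weight i] to the norm of the data, and at least [1] to the norm at time [t] for infinitely many [i]. *)
Lemma bad_speeds_of_activated lam mu1 mu2 alpha H delta sigma s Sx c :
  unbounded_dmo lam -> 0 < alpha < 1 -> 0 < H -> 2 * sigma = 1 - alpha ->
  s = 1 / (1 - alpha) -> Sx = 1 / (1 - alpha) -> PS mu1 mu2 alpha H c ->
  (forall n, exists i, (n <= i)%nat /\ activated (delta * powR (lam i) (2 * sigma)) (lam i)
     (powR (lam i) (1 - alpha) / ln (2 + lam i)) c n) ->
  bad_speeds lam mu1 mu2 alpha H delta sigma s Sx c.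
Proof.
  intros [Hlam _] Ha HH Hsig Hs HS Hc Hact. split; [exact Hc|].
  set (phi := fun i => powR (lam i) (1 - alpha) / ln (2 + lam i)) in *.
  set (P := fun k i => activated (delta * powR (lam i) (2 * sigma)) (lam i) (phi i) c k).
  assert (Hdec : forall k n i, (k <= n)%nat -> P n i -> P k i).
  { intros k n i Hkn. apply activated_le, Hkn. }
  (* Existence holds for each component separately; a choice principle assembles the whole
     sequence. *)
  assert (Hsol : forall i, {x : (R -> R) * (R -> R) * (R -> R) |
     let '(u, v, w) := x in
     oscillator_solution (delta * powR (lam i) (2 * sigma)) (lam i) c u v w /\ u 0 = 0 /\ v 0 = 1}).
  { intros i. apply constructive_indefinite_description.
    destruct (oscillator_solution_exists (delta * powR (lam i) (2 * sigma)) (lam i) mu1 mu2 alpha H c Ha HH Hc)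
      as (u & v & w & X). exists (u, v, w). exact X. }
  set (U := fun i => fst (fst (proj1_sig (Hsol i)))). set (V := fun i => snd (fst (proj1_sig (Hsol i)))).
  set (W := fun i => snd (proj1_sig (Hsol i))).
  assert (HUV : forall i, oscillator_solution (delta * powR (lam i) (2 * sigma)) (lam i) c (U i) (V i) (W i)
     /\ U i 0 = 0 /\ V i 0 = 1).
  { intros i. unfold U, V, W. destruct (Hsol i) as [[[u v] w] X]. exact X. }
  clearbody U V W. clear Hsol.
  set (a := fun i => sqrt (weight P i) * exp (- phi i)).
  assert (Ha2 : forall i, a i ^ 2 = weight P i * exp (- (2 * phi i))).
  { intros i. unfold a. replace (- (2 * phi i)) with (- phi i + - phi i) by ring. rewrite exp_plus.
    rewrite <- (sqrt_sqrt (weight P i)) at 2 by apply weight_nonneg. ring. }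
  assert (Hexp : forall i q, q = 1 / (1 - alpha) ->
     2 * powR (lam i) (1 / q) / ln (2 + lam i) = 2 * phi i).
  { intros i q ->. unfold phi. replace (1 / (1 / (1 - alpha))) with (1 - alpha) by (field; lra).
    unfold Rdiv. ring. }
  assert (Hpow0 : forall i, Rpower (1 + lam i) (4 * 0) = 1).
  { intros i. rewrite Rmult_0_r. apply Rpower_O. assert (X := Hlam i). lra. }
  assert (Hpow2 : forall i, Rpower (1 + lam i) (4 * (1 / 2)) = (1 + lam i) ^ 2).
  { intros i. replace (4 * (1 / 2)) with (INR 2) by (simpl; field). apply Rpower_pow.
    assert (X := Hlam i). lra. }
  exists (fun i t => a i * U i t), (fun i t => a i * V i t).
  split; [|split; [|split]].
  - intros i. destruct (HUV i) as [(H1 & H2 & H3 & H4) _]. exists (fun t => a i * W i t).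
    split; [apply deriv_nonneg_scal, H1|split; [apply deriv_nonneg_scal, H2|split; [apply cont_nonneg_scal, H3|]]].
    intros t Ht. specialize (H4 t Ht).
    transitivity (a i * (W i t + 2 * (delta * powR (lam i) (2 * sigma)) * V i t + c t * lam i ^ 2 * U i t)); [ring|].
    rewrite H4. ring.
  (* All initial positions vanish; only the velocities carry data. *)
  - apply summable_ext with (2 := summable_0). intros i.
    destruct (HUV i) as (_ & H1 & _). rewrite H1. ring.
  - apply summable_ext with (2 := weight_summable P). intros i.
    destruct (HUV i) as (_ & _ & H1). rewrite H1, Hpow0, (Hexp i s Hs), Rmult_1_r, Rmult_1_r, Ha2.
    rewrite Rmult_assoc, <- exp_plus, Rplus_opp_l, exp_0. ring.
  - intros t Ht [Gu Gv].
    (* From some index on both series have terms below 1/2, whereas at a chosen activated index the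
       two terms add up to at least 1. *)
    destruct (summable_eventually_small _ (1 / 2) Gu) as [N1 HN1]; [lra|].
    destruct (summable_eventually_small _ (1 / 2) Gv) as [N2 HN2]; [lra|].
    (* For k >= N3 the time t lies in the interval [1/(k+1), k+1] of activation at level k. *)
    destruct (INR_unbounded (Rmax t (/ t))) as [N3 HN3].
    assert (t <= Rmax t (/ t)) by apply Rmax_l. assert (/ t <= Rmax t (/ t)) by apply Rmax_r.
    assert (Hit : 0 < / t) by (apply Rinv_0_lt_compat, Ht).
    destruct (chosen_frequent P Hdec Hact (Nat.max N1 (Nat.max N2 N3))) as (i & Hi & Hl & HP & Hw).
    set (k := level P i) in *.
    assert (HkN : INR N3 <= INR k) by (apply le_INR; lia).
    destruct (HUV i) as (Hsol & HU0 & HV0).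
    assert (HE : 4 ^ k * exp (4 * phi i) <= energy (lam i) (U i) (V i) t).
    { apply (HP _ _ _ Hsol HU0 HV0). split; [|lra].
      rewrite <- (Rinv_inv t). apply Rinv_le_contravar; lra. }
    specialize (HN1 i ltac:(lia)). specialize (HN2 i ltac:(lia)). cbv beta in HN1, HN2.
    rewrite Hpow2, (Hexp i Sx HS) in HN1. rewrite Hpow0, (Hexp i Sx HS), Rmult_1_r in HN2.
    rewrite Rpow_mult_distr, Ha2, Hw in HN1, HN2.
    set (x := exp (- (2 * phi i))) in *. set (y := exp (4 * phi i)) in *. set (z := 4 ^ k) in *.
    assert (Hx : 0 < x) by apply exp_pos.
    assert (Hz : 0 < z) by (apply pow_lt; lra).
    (* The exact balance: one factor exp(-2 phi) from the data, one from the weight of [G_neg], and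
       exp(4 phi) from the activation. *)
    assert (Hxy : x * x * y = 1).
    { unfold x, y. rewrite <- !exp_plus, <- exp_0. f_equal. ring. }
    unfold energy in HE.
    assert (HU : lam i ^ 2 * U i t ^ 2 <= U i t ^ 2 * (1 + lam i) ^ 2).
    { rewrite (Rmult_comm (U i t ^ 2)). apply Rmult_le_compat_r; [apply pow2_ge_0|].
      apply pow_incr. assert (X := Hlam i). lra. }
    set (p := U i t ^ 2 * (1 + lam i) ^ 2) in *. set (q := V i t ^ 2) in *.
    replace (/ z * x * U i t ^ 2 * (1 + lam i) ^ 2 * x) with (/ z * (x * x) * p) in HN1 by (unfold p; ring).
    replace (/ z * x * q * x) with (/ z * (x * x) * q) in HN2 by ring.
    assert (Hfac : 0 < / z * (x * x)).
    { apply Rmult_lt_0_compat; [apply Rinv_0_lt_compat, Hz|apply Rmult_lt_0_compat; exact Hx]. }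
    assert (Hpq : z * y <= p + q) by lra.
    apply Rmult_le_compat_l with (r := / z * (x * x)) in Hpq; [|lra].
    replace (/ z * (x * x) * (z * y)) with (x * x * y) in Hpq by (field; lra). lra.
Qed.

Theorem mainTheorem2 (lam : nat -> R) (mu1 mu2 alpha H delta sigma s Sx : R) :
  unbounded_dmo lam ->
  0 < mu1 -> mu1 < mu2 -> 0 < alpha < 1 -> 0 < H ->
  0 <= delta -> delta < H / (32 * Rpower mu2 ((1 + alpha) / 2)) ->
  2 * sigma = 1 - alpha ->
  s = 1 / (1 - alpha) -> Sx = 1 / (1 - alpha) ->
  residual_in (PS mu1 mu2 alpha H)
              (bad_speeds lam mu1 mu2 alpha H delta sigma s Sx).
Proof.
  intros Hlam Hmu1 Hmu Ha HH Hd Hd' Hsig Hs HS.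
  set (good := fun (n : nat) (c : R -> R) => exists i, (n <= i)%nat /\
    activated (delta * powR (lam i) (2 * sigma)) (lam i) (powR (lam i) (1 - alpha) / ln (2 + lam i)) c n).
  exists (fun n c => exists eps, 0 < eps /\
    forall c', PS mu1 mu2 alpha H c' -> unif_close c c' eps -> good n c').
  split; [|split].
  - intros n. apply open_robust.
  - intros n c Hc eps Heps.
    destruct (activating_speed mu1 mu2 alpha H delta c eps n Hmu1 Hmu Ha HH Hd Hd' Hc Heps) as [M HM].
    (* The maximum with 0 also forces [lam i > 0], where [powR] agrees with [Rpower]. *)
    destruct (proj2 (proj2 Hlam) (Rmax M 0)) as [N HN].
    set (i := Nat.max n N). specialize (HN i ltac:(lia)).
    assert (M <= Rmax M 0) by apply Rmax_l. assert (0 <= Rmax M 0) by apply Rmax_r.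
    destruct (HM (lam i) ltac:(lra)) as (c' & u & v & w & HPS & Hclose & Hsol & Hu & Hv & HE).
    exists c'. split; [exact HPS|split; [|exact Hclose]].
    rewrite <- powR_pos_eq in Hsol, HE by lra.
    destruct (activated_stable mu2 _ (lam i) _ c' u v w n
      (Rmult_le_pos _ _ Hd (powR_nonneg _ _)) ltac:(lra) ltac:(lra) Hsol Hu Hv HE) as (e & He & Hact).
    exists e. split; [exact He|]. intros c'' Hc'' Hcc''. exists i. split; [lia|].
    rewrite Hsig. apply Hact; [|exact Hcc'']. intros t Ht. destruct (proj1 Hc'' t Ht). lra.
  - intros c Hc HU. apply bad_speeds_of_activated; try assumption.
    (* A robustly good speed is good: it lies in its own ball. *)
    intros n. destruct (HU n) as (e & He & Hgood). apply Hgood; [exact Hc|].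
    intros t _. rewrite Rminus_diag, Rabs_R0. lra.
Qed.
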